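(* Any signed tree model with loops can be transformed in linear time into an equivalent signed tree model (representing the same graph) without loops. The only new transversal pairs created in this transformation form a matching; in particular, at most $n$ transversal pairs are added, where $n$ is the number of leaves.
   Context: For a rooted tree $T$, $u\preceq_T v$ means $u$ is an ancestor of $v$ (possibly equal). A transversal pair of $T$ is an unordered pair $uv$ of distinct nodes neither of which is an ancestor of the other. Two pairs $u_1v_1,u_2v_2$ cross if one of $u_1,v_1$ is a strict ancestor of one of $u_2,v_2$ and vice versa. A signed tree model is $(T,A,B)$ with $T$ full binary and $A,B$ disjoint sets of pairwise non-crossing transversal pairs (negative and positive pairs). A signed tree model with loops additionally allows pairs $tt$ (loops) of a single node in $A$ or $B$. A pair $u'v'\in A\cup B$ (possibly a loop, $u'=v'$) covers a pair of nodes $u,v$ if $u'\preceq_T u$, $v'\preceq_T v$, and no other pair $u''v''\in A\cup B$ satisfies $u'\preceq_T u''\preceq_T u$ and $v'\preceq_T v''\preceq_T v$. The represented graph has the leaves of $T$ as vertices, two distinct leaves being adjacent iff they are covered by a positive pair. *)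

(* Defs.v *)
From mathcomp Require Import all_boot.

Set Implicit Arguments.
Unset Strict Implicit.
Unset Printing Implicit Defensive.

(* A rooted tree on the node set V, given by its parent map; by convention the
   root is its own parent, and reaching the root from every node excludes any
   other cycle. *)
Record rooted_tree (V : finType) := RootedTree {
  tree_root : V;
  parent : V -> V;
  parent_tree_root : parent tree_root = tree_root;
  tree_root_reachable : forall v, fconnect parent v tree_root
}.

Section SignedTreeModels.

Variables (V : finType) (T : rooted_tree V).
Implicit Types (u v t : V) (p q : {set V}) (A B S : {set {set V}}).

Definition ancestor u v : bool := fconnect (parent T) v u.

Definition strict_ancestor u v : bool := (u != v) && ancestor u v.

Definition children u : {set V} := [set v | (v != tree_root T) && (parent T v == u)].

Definition leaf u : bool := children u == set0.

Definition full_binary : Prop := forall u, leaf u \/ #|children u| = 2.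

(* An unordered pair uv is the set [set u; v]; the loop tt is the singleton
   [set t; t] = [set t]. *)
Definition transversal_pair p : bool :=
  [exists u, exists v, [&& p == [set u; v], u != v,
                           ~~ ancestor u v & ~~ ancestor v u]].

Definition loop_pair p : bool := [exists t, p == [set t]].

Definition cross p q : bool :=
  [exists x in p, exists y in q, strict_ancestor x y] &&
  [exists y in q, exists x in p, strict_ancestor y x].

Definition noncrossing S : Prop := {in S &, forall p q, ~~ cross p q}.

(* A is the set of negative pairs, B the set of positive pairs. *)
Definition signed_tree_model A B : Prop :=
  [/\ full_binary, [disjoint A & B],
      {in A :|: B, forall p, transversal_pair p} & noncrossing (A :|: B)].

Definition signed_tree_model_with_loops A B : Prop :=
  [/\ full_binary, [disjoint A & B],
      {in A :|: B, forall p, transversal_pair p || loop_pair p} & noncrossing (A :|: B)].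

Definition covers S p u v : bool :=
  (p \in S) &&
  [exists u1, exists v1,
    [&& p == [set u1; v1], ancestor u1 u, ancestor v1 v &
      [forall u2, forall v2,
        [&& [set u2; v2] \in S, ancestor u1 u2, ancestor u2 u,
            ancestor v1 v2 & ancestor v2 v] ==> ([set u2; v2] == p)]]].

Definition represented_graph A B : rel {v : V | leaf v} :=
  [rel x y | (x != y) &&
             [exists p in B, covers (A :|: B) p (val x) (val y)]].

Definition new_pairs A B A' B' : {set {set V}} := (A' :|: B') :\: (A :|: B).

(* Encoding of a model as a sequence of machine words.  Nodes are numbered
   0, ..., #|V| - 1 and the tree is stored as its parent array.  The pairs are
   listed in any order and each pair in any orientation, so that one model has
   many codes. *)
Definition node_code (v : V) : nat := enum_rank v.

Definition lists_pairs (s : seq (V * V)) S : Prop :=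
  perm_eq [seq [set x.1; x.2] | x <- s] (enum S).

Definition pairs_code (s : seq (V * V)) : seq nat :=
  size s :: flatten [seq [:: node_code x.1; node_code x.2] | x <- s].

Definition model_code A B (l : seq nat) : Prop :=
  exists sA sB : seq (V * V),
    [/\ lists_pairs sA A, lists_pairs sB B &
        l = #|V| :: [seq node_code (parent T v) | v <- enum V]
              ++ pairs_code sA ++ pairs_code sB].

End SignedTreeModels.

Arguments represented_graph {V} T A B.

(* Word RAM: finitely many registers (those a program mentions) and a random
   access memory.  Each elementary operation and each test costs one unit of
   time.  The parameter w bounds the values of words: an operation whose result
   is not below w has no transition, so w polynomial in the input length means
   words of logarithmically many bits. *)
Inductive test :=
  | TestEq of nat & nat
  | TestLt of nat & nat.

Inductive command :=
  | Skip
  | Const of nat & nat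
  | Add of nat & nat & nat
  | Sub of nat & nat & nat
  | Read of nat & nat
  | Write of nat & nat
  | Seq of command & command
  | If of test & command & command
  | While of test & command.

Record state := State { regs : nat -> nat; mem : nat -> nat }.

Definition update (f : nat -> nat) (i x : nat) : nat -> nat :=
  fun j => if j == i then x else f j.

Definition set_reg (s : state) (r x : nat) : state :=
  State (update (regs s) r x) (mem s).

Definition set_mem (s : state) (a x : nat) : state :=
  State (regs s) (update (mem s) a x).

Definition eval_test (s : state) (b : test) : bool :=
  match b with
  | TestEq i j => regs s i == regs s j
  | TestLt i j => regs s i < regs s j
  end.

(* exec w P s n s': started in state s, P halts in state s' after n steps. *)
Inductive exec (w : nat) : command -> state -> nat -> state -> Prop :=
  | ExecSkip s : exec w Skip s 1 s
  | ExecConst s r k : k < w -> exec w (Const r k) s 1 (set_reg s r k)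
  | ExecAdd s r i j : regs s i + regs s j < w ->
      exec w (Add r i j) s 1 (set_reg s r (regs s i + regs s j))
  | ExecSub s r i j :
      exec w (Sub r i j) s 1 (set_reg s r (regs s i - regs s j))
  | ExecRead s r i : exec w (Read r i) s 1 (set_reg s r (mem s (regs s i)))
  | ExecWrite s i j : exec w (Write i j) s 1 (set_mem s (regs s i) (regs s j))
  | ExecSeq s s1 s2 P Q m n :
      exec w P s m s1 -> exec w Q s1 n s2 -> exec w (Seq P Q) s (m + n) s2
  | ExecIfTrue s s1 b P Q n : eval_test s b ->
      exec w P s n s1 -> exec w (If b P Q) s n.+1 s1
  | ExecIfFalse s s1 b P Q n : ~~ eval_test s b ->
      exec w Q s n s1 -> exec w (If b P Q) s n.+1 s1
  | ExecWhileFalse s b P : ~~ eval_test s b -> exec w (While b P) s 1 s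
  | ExecWhileTrue s s1 s2 b P m n : eval_test s b ->
      exec w P s m s1 -> exec w (While b P) s1 n s2 ->
      exec w (While b P) s (m + n).+1 s2.

Definition input_state (l : seq nat) : state :=
  State (fun _ => 0) (fun a => nth 0 l a).

(* Register 0 holds the address at which the output starts. *)
Definition outputs (s : state) (l : seq nat) : Prop :=
  forall i, i < size l -> mem s (regs s 0 + i) = nth 0 l i.

(* Both the running time and the word bound are c times the input length. *)
Definition linear_time_run (P : command) (c : nat) (l l' : seq nat) : Prop :=
  exists (n : nat) (s : state),
    [/\ exec (c * size l) P (input_state l) n s, n <= c * size l & outputs s l'].

(* Main.v *)
(* A loop at t covers the pairs of leaves below t that no transversal pair and no
   lower loop takes over.  Let x and y be distinct leaves whose lowest common
   ancestor u has children a and b, with a above x and b above y.  Every transversal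
   pair above (x, y) lies weakly below (a, b), and every loop above (x, y) sits at an
   ancestor of u.  Hence all loops may be dropped if, for each inner node u whose
   children do not already form a pair of the model, the sibling pair ab is added with
   the sign of the lowest loop at an ancestor of u (and not at all without such a
   loop).  Sibling pairs are pairwise disjoint, cross no transversal pair, and number
   at most the inner nodes.

   In linear time: one pass over the parent array lists the children, one pass over the
   pairs records the loops and the sibling pairs present, and a breadth-first
   traversal pushes the sign of the lowest loop down the tree. *)

From mathcomp Require Import all_boot zify.
Require Import Defs.

Set Implicit Arguments.
Unset Strict Implicit.
Unset Printing Implicit Defensive.

(** * Rooted trees *)

(** The numbering of the nodes is arbitrary: a parent may come after its child, so one scan of the
    parent array cannot push signs downwards, and a queue is needed. What the traversal leaves
    behind is known only through the local equation [propagates]. That equation is the whole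
    interface between the two halves: the graph argument accepts any solution of it, and the program
    proof never speaks of lowest loops.

    Asking whether a sibling pair already belongs to the model must take constant time, without
    searching the lists. In a transversal pair, ends with equal parents are the two children of that
    parent, so one mark at the parent records the pair; orientation and sign are irrelevant, since a
    pair of either sign takes over from the loops.

    Every loop of the program runs a number of rounds fixed by the input: the number of nodes or the
    length of a list. Time bounds therefore reduce to invariants indexed by the round and to
    loop-free bodies of constant cost. *)

Section Tree.

Variables (V : finType) (T : rooted_tree V).
Implicit Types (u v t x y : V).

Local Notation anc := (ancestor T).
Local Notation par := (parent T).
Local Notation root := (tree_root T).

Lemma ancestorP u v : reflect (exists k, u = iter k par v) (anc u v).
Proof.
apply: (iffP idP) => [uv|[k ->]]; last exact: fconnect_iter.
by exists (findex par v u); rewrite iter_findex.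
Qed.

Lemma ancestor_refl u : anc u u.
Proof. exact: connect0. Qed.
Hint Resolve ancestor_refl : core.

Lemma ancestor_trans v u t : anc u v -> anc v t -> anc u t.
Proof. by move=> uv vt; apply: connect_trans uv. Qed.

Lemma ancestor_root v : anc root v.
Proof. exact: tree_root_reachable. Qed.

Lemma ancestor_parent v : anc (par v) v.
Proof. exact: fconnect1. Qed.

Lemma ancestor_parentVeq u v : anc u v -> u = v \/ anc u (par v).
Proof.
case/ancestorP=> -[|k] ->; first by left.
by right; rewrite iterSr; apply/ancestorP; exists k.
Qed.

Definition depth v := findex par v root.

Lemma depth_parent v : depth (par v) = (depth v).-1.
Proof.
rewrite /depth; have [->|vr] := eqVneq v root.
  by rewrite parent_tree_root findex0.
by rewrite (fconnect_findex (tree_root_reachable T v)) 1?eq_sym.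
Qed.

Lemma depth_iter k v : depth (iter k par v) = depth v - k.
Proof. by elim: k => [|k IHk] /=; rewrite ?subn0 // depth_parent IHk subnS. Qed.

Lemma depth_eq0 v : depth v = 0 -> v = root.
Proof.
by move=> d0; rewrite -(iter_findex (tree_root_reachable T v)) -/(depth v) d0.
Qed.

Lemma parent_fix v : (par v == v) = (v == root).
Proof.
apply/eqP/eqP => [pv|->]; last exact: parent_tree_root.
apply: depth_eq0; have := depth_parent v; rewrite pv; lia.
Qed.

(** Going up from [v] to [u] and from there to [v] lowers the depth, unless no step is made or both
    depths are 0, in which case both nodes are the root. *)
Lemma ancestor_anti u v : anc u v -> anc v u -> u = v.
Proof.
move=> /ancestorP[i ui] /ancestorP[j vj].
have du := depth_iter i v; have dv := depth_iter j u; rewrite -ui in du; rewrite -vj in dv.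
case: i ui du => [//|i] ui du.
by transitivity (tree_root T); [|symmetry]; apply: depth_eq0; lia.
Qed.

Lemma ancestor_total u1 u2 v : anc u1 v -> anc u2 v -> anc u1 u2 \/ anc u2 u1.
Proof.
move=> /ancestorP[i ->] /ancestorP[j ->].
have [ij|/ltnW ji] := leqP i j; [right|left]; apply/ancestorP.
  by exists (j - i); rewrite -iterD subnK.
by exists (i - j); rewrite -iterD subnK.
Qed.

Lemma in_children u v : (v \in children T u) = (v != root) && (par v == u).
Proof. by rewrite inE. Qed.

Lemma ancestor_child u v : v \in children T u -> anc u v.
Proof. by rewrite in_children => /andP[_ /eqP<-]; apply: ancestor_parent. Qed.

Lemma child_neq u v : v \in children T u -> u != v.
Proof.
by rewrite in_children -parent_fix => /andP[+ /eqP<-].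
Qed.

Lemma child_not_ancestor u v : v \in children T u -> ~~ anc v u.
Proof.
move=> cv; apply/negP => vu; have /eqP[] := child_neq cv.
exact: ancestor_anti (ancestor_child cv) vu.
Qed.

Lemma ancestor_childVeq u v t :
  v \in children T t -> anc u v -> u = v \/ anc u t.
Proof.
by rewrite in_children => /andP[_ /eqP<-]; apply: ancestor_parentVeq.
Qed.

Lemma child_towards u v : anc u v -> u != v ->
  exists2 b, b \in children T u & anc b v.
Proof.
case/ancestorP=> k ->; elim: k => [|k IHk] /=; first by rewrite eqxx.
(* If [b] is the root, the last step up stays in place and the induction hypothesis applies;
   otherwise [b] is the child sought. *)
set b := iter k par v in IHk *; have [->|pb _] := eqVneq (par b) b; first exact: IHk.
exists b; last by apply/ancestorP; exists k.
by rewrite in_children eqxx -parent_fix pb.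
Qed.

Lemma leaf_ancestor u v : leaf T u -> anc u v -> u = v.
Proof.
move=> /eqP lu uv; apply/eqP/negPn/negP => /(child_towards uv)[b].
by rewrite lu inE.
Qed.

Lemma children_leaf u v : v \in children T u -> ~~ leaf T u.
Proof. by move=> vu; apply/eqP => u0; rewrite u0 inE in vu. Qed.

Lemma siblings_incomparable t a b :
  a \in children T t -> b \in children T t -> a != b -> ~~ anc a b.
Proof.
move=> ca cb ab; apply/negP => /(ancestor_childVeq cb)[/eqP|]; first by rewrite (negPf ab).
by apply/negP/child_not_ancestor.
Qed.

(** The least number of parent steps from [x] to an ancestor of [y] leads to the lowest common
    ancestor. It is positive because the leaf [x] is above no other node, and the node one step
    earlier is [a]. *)
Lemma ex_lca x y : leaf T x -> leaf T y -> x != y ->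
  exists t a b, [/\ a \in children T t, b \in children T t, a != b, anc a x & anc b y].
Proof.
move=> lx ly xy.
have [k0 rk0] := ancestorP _ _ (ancestor_root x).
have exk : exists k, anc (iter k par x) y by exists k0; rewrite -rk0 ancestor_root.
case: (ex_minnP exk) => -[|k] /= ky mink; first by rewrite (leaf_ancestor lx ky) eqxx in xy.
set a := iter k par x in ky *.
have nay : ~~ anc a y by apply/negP => /mink; rewrite ltnn.
have ca : a \in children T (par a).
  by rewrite in_children eqxx -parent_fix andbT; apply: contra nay => /eqP<-.
have [|b cb by_] := child_towards ky.
  by apply: contraTneq ly => <-; apply: children_leaf ca.
exists (par a), a, b; split=> //; first by apply: contraNneq nay => ->.
by apply/ancestorP; exists k.
Qed.

Lemma transversal_pairP p :
  reflect (exists u v, [/\ p = [set u; v], ~~ anc u v & ~~ anc v u])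
          (transversal_pair T p).
Proof.
apply: (iffP existsP) => [[u /existsP[v /and4P[/eqP-> _ uv vu]]]|[u [v [-> uv vu]]]].
  by exists u, v.
exists u; apply/existsP; exists v; rewrite eqxx uv vu !andbT /=.
by apply: contraNneq uv => ->.
Qed.

Lemma transversal_set2 u v :
  transversal_pair T [set u; v] = ~~ anc u v && ~~ anc v u.
Proof.
apply/transversal_pairP/andP => [[u1 [v1 [E h1 h2]]]|[]]; last by exists u, v.
have: u1 \in [set u; v] by rewrite E set21.
have: v1 \in [set u; v] by rewrite E set22.
by case/set2P=> ? /set2P[] ?; subst; rewrite ?ancestor_refl in h1 h2 *.
Qed.

Lemma loop_pairP p : reflect (exists t, p = [set t]) (loop_pair p).
Proof. exact: 'exists_eqP. Qed.

Lemma loop_pair_card (p : {set V}) : loop_pair p -> #|p| = 1.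
Proof. by case/loop_pairP=> t ->; rewrite cards1. Qed.

Lemma loop_set2 u v : loop_pair [set u; v] = (u == v).
Proof.
apply/idP/eqP => [/loop_pair_card|->]; last by apply/loop_pairP; exists v; rewrite setUid.
by rewrite cards2; case: eqP.
Qed.

(** * Full binary trees: sibling pairs and the number of inner nodes *)

Section Binary.

Hypothesis binT : full_binary T.

Lemma card_children u : #|children T u| = 2 * ~~ leaf T u.
Proof.
case: (binT u) => [lu|c2]; first by rewrite lu; move/eqP: lu ->; rewrite cards0.
by rewrite c2 /leaf -cards_eq0 c2.
Qed.

Lemma children_eq2 t a b : a \in children T t -> b \in children T t -> a != b ->
  children T t = [set a; b].
Proof.
move=> ca cb ab; apply/esym/eqP; rewrite eqEcard card_children cards2 ab.
by rewrite (negPf (children_leaf ca)) andbT subUset !sub1set ca cb.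
Qed.

Lemma children_split u : ~~ leaf T u ->
  exists a b, [/\ a != b, children T u = [set a; b], a \in children T u & b \in children T u].
Proof.
move=> lu; have /cards2P[a [b [ab E]]] : #|children T u| == 2 by rewrite card_children lu.
by exists a, b; split; rewrite // E ?set21 ?set22.
Qed.

Lemma children_transversal u : ~~ leaf T u -> transversal_pair T (children T u).
Proof.
case/children_split=> a [b [ab E ca cb]]; apply/transversal_pairP; exists a, b.
have ba : b != a by rewrite eq_sym.
by split=> //; [apply: siblings_incomparable ca cb _|apply: siblings_incomparable cb ca _].
Qed.

Lemma children_inj u v : ~~ leaf T u -> children T u = children T v -> u = v.
Proof.
move=> /set0Pn[a au] E; have av := au; rewrite E in av.
by move: au av; rewrite !in_children => /andP[_ /eqP<-] /andP[_ /eqP].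
Qed.

(** Count the nodes other than the root by their parents: with [i] inner nodes and [l] leaves,
    [2 * i = i + l - 1]. *)
Lemma card_inner_leaves : #|[set v | ~~ leaf T v]| < #|[set v | leaf T v]|.
Proof.
have sumE : \sum_u #|children T u| = #|V|.-1.
  rewrite -(cardC1 (tree_root T)) -[RHS]sum1_card [RHS](partition_big par predT) //=.
  apply: eq_bigr => u _; rewrite -sum1_card; apply: eq_bigl => v.
  by rewrite in_children.
have cardE : #|[set v | leaf T v]| + #|[set v | ~~ leaf T v]| = #|V|.
  by rewrite -(cardsC [set v | leaf T v]); congr (_ + _); apply: eq_card => v; rewrite !inE.
have : 0 < #|V| by apply/card_gt0P; exists root.
move: sumE; under eq_bigr do rewrite card_children.
rewrite -big_distrr -big_mkcond sum1_card /= -cardsE.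
move=> sumE V0; move: sumE cardE V0; set X := #|_|; set Y := #|_|; set Z := #|_|.
lia.
Qed.

(* A strict ancestor of a child of u is an ancestor of u, hence comparable to every
   descendant of u, which its partner in a transversal pair is not. *)
Lemma children_cross_free u p :
  transversal_pair T p -> ~~ cross T p (children T u) /\ ~~ cross T (children T u) p.
Proof.
have H x y c : ~~ anc x y -> ~~ anc y x -> strict_ancestor T x c -> c \in children T u ->
    forall d, d \in children T u -> ~~ strict_ancestor T d y && ~~ strict_ancestor T d x.
  move=> xy yx /andP[xc axc] cc d cd.
  have xu : anc x u by case: (ancestor_childVeq cc axc) xc => // ->; rewrite eqxx.
  rewrite /strict_ancestor !negb_and !negbK; apply/andP; split; apply/orP; right.
    apply: contra xy => dy; apply: ancestor_trans xu _.
    exact: ancestor_trans (ancestor_child cd) dy.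
  apply: contra (child_not_ancestor cd) => dx; exact: ancestor_trans dx xu.
case/transversal_pairP=> x [y [-> xy yx]].
have K : ~~ (
  [exists x0 in [set x; y], exists y0 in children T u, strict_ancestor T x0 y0] &&
  [exists y0 in children T u, exists x0 in [set x; y], strict_ancestor T y0 x0]).
  apply/andP=> -[/exists_inP[z zp /exists_inP[c cc zc]]].
  case/exists_inP=> d cd /exists_inP[z' zp' dz'].
  have := H _ _ _ xy yx; have := H _ _ _ yx xy.
  move: zp zc zp' dz' => /set2P[]-> zc /set2P[]-> dz' H1 H2.
  - by have := H2 _ zc cc _ cd; rewrite dz' andbF.
  - by have := H2 _ zc cc _ cd; rewrite dz'.
  - by have := H1 _ zc cc _ cd; rewrite dz'.
  - by have := H1 _ zc cc _ cd; rewrite dz' andbF.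
by split; rewrite /cross // andbC.
Qed.

End Binary.

(** * Pairs above two leaves with a given lowest common ancestor *)

Section Lca.

Variables (t a b x y : V).
Hypotheses (ca : a \in children T t) (cb : b \in children T t) (ab : a != b).
Hypotheses (ax : anc a x) (yb : anc b y).

Lemma lca_fst_above : ~~ anc a y.
Proof.
apply/negP => ay; have [] := ancestor_total ay yb; apply/negP.
  exact: siblings_incomparable ca cb ab.
by apply: siblings_incomparable cb ca _; rewrite eq_sym.
Qed.

Lemma lca_common s : anc s x -> anc s y -> anc s t.
Proof.
move=> sx sy; have [sa|as_] := ancestor_total sx ax; last first.
  by case/negP: lca_fst_above; apply: ancestor_trans sy.
case: (ancestor_childVeq ca sa) => // E.
by case/negP: lca_fst_above; rewrite -E.
Qed.

End Lca.

Section LcaPairs.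

Variables (t a b x y : V).
Hypotheses (ca : a \in children T t) (cb : b \in children T t) (ab : a != b).
Hypotheses (ax : anc a x) (yb : anc b y).

(** An end that is an ancestor of [t] would be above both leaves, hence comparable with the other
    end. So each end lies strictly below [t] on the way to its leaf, that is, weakly below the child
    of [t] on that way. *)
Lemma lca_transversal u v : transversal_pair T [set u; v] -> anc u x -> anc v y ->
  anc a u /\ anc b v.
Proof.
rewrite transversal_set2 => /andP[uv vu] ux vy.
have side c z w : c \in children T t -> anc c z -> anc w z -> ~~ anc w t -> anc c w.
  move=> cc cz wz wt; have [//|wc] := ancestor_total cz wz.
  by case: (ancestor_childVeq cc wc) wt => [->|->].
have [ty tx] : anc t y /\ anc t x.
  by split; [exact: ancestor_trans (ancestor_child cb) yb
            |exact: ancestor_trans (ancestor_child ca) ax].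
split; [apply: (side _ x)|apply: (side _ y)] => //; apply/negP => h.
  have [] := ancestor_total (ancestor_trans h ty) vy; exact/negP.
have [] := ancestor_total (ancestor_trans h tx) ux; exact/negP.
Qed.

(** If [a] were strictly above [u], it would be above the common parent [t'], hence above [v] and
    [y]. Thus an added pair can affect only those leaf pairs whose lowest common ancestor is its
    parent. *)
Lemma lca_siblings t' u v : [set u; v] = children T t' ->
  transversal_pair T [set u; v] -> anc u x -> anc v y -> u = a /\ v = b.
Proof.
move=> E tr ux vy; have [au bv] := lca_transversal tr ux vy.
have cu : u \in children T t' by rewrite -E set21.
have cv : v \in children T t' by rewrite -E set22.
split; apply/esym.
  case: (ancestor_childVeq cu au) => // at'.
  case/negP: (lca_fst_above ca cb ab yb).
  exact: ancestor_trans (ancestor_trans at' (ancestor_child cv)) vy.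
case: (ancestor_childVeq cv bv) => // bt'.
have ba : b != a by rewrite eq_sym.
case/negP: (lca_fst_above cb ca ba ax).
exact: ancestor_trans (ancestor_trans bt' (ancestor_child cu)) ux.
Qed.

End LcaPairs.

End Tree.

(** * Replacing loops by sibling pairs *)

Section Labels.

Variables (V : finType) (T : rooted_tree V) (lab : V -> nat).
Local Notation anc := (ancestor T).

Definition closest t s :=
  [/\ anc s t, lab s != 0 & forall s', lab s' != 0 -> anc s' t -> anc s' s].

Definition propagates (e : V -> nat) :=
  forall v, e v = if (lab v == 0) && (v != tree_root T) then e (parent T v) else lab v.

Variable e : V -> nat.
Hypothesis eP : propagates e.

(** Induction on the depth: the equation refers only to the parent, and the root reads its own
    label. *)
Lemma propagates_closest t : (e t != 0 -> exists2 s, closest t s & e t = lab s) /\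
  (e t = 0 -> forall s, anc s t -> lab s = 0).
Proof.
have [n dn] := ubnP (depth T t); elim: n t dn => // n IHn t dn.
rewrite eP; case: ifPn => [/andP[/eqP t0 tr]|].
  have [|IH1 IH2] := IHn (parent T t).
    rewrite depth_parent; have : depth T t != 0 by apply: contraNneq tr => /depth_eq0->.
    by move: dn; case: depth.
  split=> [/IH1[s [st s0 smax] es]|/IH2 H s].
    exists s => //; split=> //; first exact: ancestor_trans st (ancestor_parent T t).
    move=> s' s'0 /ancestor_parentVeq[E|]; last exact: smax.
    by rewrite E t0 in s'0.
  by case/ancestor_parentVeq=> [->|/H].
rewrite negb_and negbK => t0; split=> [nt|t0'].
  by exists t => //; split=> //; apply: ancestor_refl.
move: t0; rewrite t0' /= => /eqP tr s.
case/ancestor_parentVeq=> [->//|]; rewrite tr parent_tree_root => sr.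
by rewrite (ancestor_anti sr (ancestor_root T s)) -tr.
Qed.

Lemma closest_propagates t s : closest t s -> e t = lab s.
Proof.
case: (propagates_closest t) => H1 H2 [st s0 smax].
have [|s' [st' s0' smax'] ->] := H1; first by apply: contraNneq s0 => /H2->.
by congr lab; apply: ancestor_anti; [exact: smax|exact: smax'].
Qed.

End Labels.

(** * The loopless model and the graph it represents *)

Section Transformation.

Variables (V : finType) (T : rooted_tree V) (A B : {set {set V}}).
Hypothesis modelAB : signed_tree_model_with_loops T A B.
Local Notation anc := (ancestor T).

(* 1 stands for a negative loop and 2 for a positive one. *)
Definition loop_label v : nat :=
  if [set v] \in B then 2 else if [set v] \in A then 1 else 0.

Variable e : V -> nat.
Hypothesis eP : propagates T loop_label e.

Definition new_nodes sg : {set V} :=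
  [set u | [&& e u == sg, children T u \notin A :|: B & ~~ leaf T u]].

Definition loopless (S : {set {set V}}) sg : {set {set V}} :=
  [set p in S | transversal_pair T p] :|: [set children T u | u in new_nodes sg].

Let binT : full_binary T. Proof. by case: modelAB. Qed.

Lemma loopless_transversal S sg p : p \in loopless S sg -> transversal_pair T p.
Proof.
case/setUP=> [|/imsetP[u]]; first by rewrite inE => /andP[].
by rewrite inE => /and3P[_ _ nl] ->; apply: children_transversal.
Qed.

Lemma loop_label_neq0 v : (loop_label v != 0) = ([set v] \in A :|: B).
Proof. by rewrite inE /loop_label; case: (_ \in B); case: (_ \in A). Qed.

Lemma model_pairP p : p \in A :|: B ->
  transversal_pair T p \/ exists t, p = [set t].
Proof. by case: modelAB => _ _ H _ /H/orP[|/loop_pairP]; [left|right]. Qed.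

Lemma model_disjoint p : p \in A -> p \in B -> False.
Proof. by case: modelAB => _ /disjointFr H _ _ /H->. Qed.

Lemma loopless_cupP p : p \in loopless A 1 :|: loopless B 2 ->
  (p \in A :|: B) && transversal_pair T p \/
  exists2 u, p = children T u & children T u \notin A :|: B /\ ~~ leaf T u.
Proof.
have H (S : {set {set V}}) sg : S \subset A :|: B -> p \in loopless S sg ->
    (p \in A :|: B) && transversal_pair T p \/
    exists2 u, p = children T u & children T u \notin A :|: B /\ ~~ leaf T u.
  move=> sS /setUP[|/imsetP[u]]; rewrite inE.
    by case/andP=> pS tp; left; rewrite (subsetP sS).
  by case/and3P=> _ ? ? ->; right; exists u.
by case/setUP; apply: H; rewrite ?subsetUl ?subsetUr.
Qed.

Lemma loopless_cup p : p \in A :|: B -> transversal_pair T p ->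
  p \in loopless A 1 :|: loopless B 2.
Proof. by move=> /setUP[] pS tp; rewrite !inE pS tp ?orbT. Qed.

(** For disjointness: two kept pairs are separated by the given model, a kept and an added pair
    because added pairs lie outside [A :|: B], and two added pairs because the pair determines its
    parent [u], and [e u] is a single sign. *)
Lemma loopless_model : signed_tree_model T (loopless A 1) (loopless B 2).
Proof.
split=> //.
- apply/pred0P => p /=; apply/negP => /andP[].
  case/setUP=> [|/imsetP[u]]; rewrite inE.
    case/andP=> pA _ /setUP[|/imsetP[v]]; rewrite inE.
      by case/andP=> pB; have := model_disjoint pA pB.
    by case/and3P=> _ + _ E; rewrite -E inE pA.
  case/and3P=> /eqP eu nu lu -> /setUP[|/imsetP[v]]; rewrite inE.
    by case/andP=> pB; move: nu; rewrite inE pB orbT.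
  by case/and3P=> /eqP ev _ _ /(children_inj lu) E; move: ev; rewrite -E eu.
- by move=> p /setUP[]/loopless_transversal.
- move=> p q pS qS.
  have trp : transversal_pair T p by case/setUP: pS => /loopless_transversal.
  have trq : transversal_pair T q by case/setUP: qS => /loopless_transversal.
  have [/andP[pAB _]|[u -> _]] := loopless_cupP pS; last by case: (children_cross_free u trq).
  have [/andP[qAB _]|[u -> _]] := loopless_cupP qS; last by case: (children_cross_free u trp).
  by case: modelAB => _ _ _; apply.
Qed.

Lemma coversP (S : {set {set V}}) p u v : reflect
  [/\ p \in S & exists u1 v1, [/\ p = [set u1; v1], anc u1 u, anc v1 v &
     forall u2 v2, [set u2; v2] \in S -> anc u1 u2 -> anc u2 u -> anc v1 v2 ->
       anc v2 v -> [set u2; v2] = p]] (covers T S p u v).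
Proof.
apply: (iffP andP) => -[pS].
  case/existsP=> u1 /existsP[v1 /and4P[/eqP pE a1 a2 /forallP H]]; split=> //.
  exists u1, v1; split=> // u2 v2 ? ? ? ? ?; apply/eqP.
  by have /forallP/(_ v2)/implyP := H u2; apply; apply/and5P.
case=> u1 [v1 [pE a1 a2 H]]; split=> //; apply/existsP; exists u1; apply/existsP; exists v1.
rewrite -pE eqxx a1 a2; apply/forallP => u2; apply/forallP => v2.
by apply/implyP => /and5P[*]; apply/eqP/H.
Qed.

Lemma set2_eq1 (u v s : V) : [set u; v] = [set s] -> u = s /\ v = s.
Proof.
by move=> E; split; apply/set1P; rewrite -E ?set21 ?set22.
Qed.

Lemma loopless_graph :
  represented_graph T (loopless A 1) (loopless B 2) =2 represented_graph T A B.
Proof.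
move=> [x lx] [y ly]; apply: andb_id2l; rewrite -val_eqE /= => xy.
apply/idP/idP.
all: have [t [a [b [ca cb ab ax by_]]]] := ex_lca lx ly xy.
all: have aNy := lca_fst_above ca cb ab by_.
all: have chE := children_eq2 binT ca cb ab.
all: have lt := children_leaf ca.
all: have at_ := ancestor_child ca; have bt := ancestor_child cb.
- case/exists_inP=> p pB' /coversP[pS' [u1 [v1 [pE u1x v1y pmax]]]].
  have trp : transversal_pair T [set u1; v1] by rewrite -pE; apply: loopless_transversal pB'.
  have [au1 bv1] := lca_transversal ca cb ax by_ trp u1x v1y.
  case/setUP: pB' => [|/imsetP[t']]; rewrite inE.
    (* A kept pair. The only further competitors in the old model are loops, and a loop below both
       ends would lie below [a] and above [y]. *)
    case/andP=> pB _; apply/exists_inP; exists p => //; apply/coversP.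
    split; first by rewrite inE pB orbT.
    exists u1, v1; split=> // u2 v2 uvS u12 u2x v12 v2y.
    have [tr|[s /set2_eq1[E1 E2]]] := model_pairP uvS.
      by apply: pmax => //; apply: loopless_cup.
    case/negP: aNy; rewrite E1 in u12; rewrite E2 in v2y.
    exact: ancestor_trans au1 (ancestor_trans u12 v2y).
  (* An added pair. It must be [[set a; b]], and [e t = 2] provides a positive closest loop at some
     [s], which covers [x] and [y] in the old model. *)
  case/and3P=> /eqP et' nS lt' pE'.
  have [E1 E2] : u1 = a /\ v1 = b.
    by apply: (lca_siblings ca cb ab ax by_ (t' := t')) => //; rewrite -pE.
  have E : t' = t by apply: (children_inj lt'); rewrite -pE' chE pE E1 E2.
  rewrite {}E in et' nS lt' pE'; have [H _] := propagates_closest eP t.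
  rewrite et' in H; have {H} [//|s [st s0 smax] labs] := H.
  have sB : [set s] \in B.
    by move: labs; rewrite /loop_label; case: (_ \in B) => //; case: (_ \in A).
  apply/exists_inP; exists [set s] => //; apply/coversP; split; first by rewrite inE sB orbT.
  exists s, s; split; rewrite ?setUid //.
  + exact: ancestor_trans (ancestor_trans st at_) ax.
  + exact: ancestor_trans (ancestor_trans st bt) by_.
  (* A transversal competitor lies below [(a, b)], so it would take over from the added pair too; a
     competing loop is above [t], hence not strictly below [s]. *)
  move=> u2 v2 uvS su2 u2x sv2 v2y.
  have [tr|[s2 sE]] := model_pairP uvS.
    have [au2 bv2] := lca_transversal ca cb ax by_ tr u2x v2y.
    case/negP: nS; rewrite -pE' -(pmax u2 v2) ?E1 ?E2 //.
    exact: loopless_cup.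
  rewrite sE; have [E3 E4] := set2_eq1 sE; rewrite {}E3 {}E4 in su2 u2x sv2 v2y uvS.
  rewrite setUid in uvS.
  rewrite (@ancestor_anti _ T s2 s) //; apply: smax; first by rewrite loop_label_neq0.
  exact: (lca_common ca cb ab ax by_ u2x v2y).
case/exists_inP=> p pB /coversP[pS [u1 [v1 [pE u1x v1y pmax]]]].
have [tr|[s sE]] := model_pairP pS.
  have pB' : p \in loopless B 2 by rewrite !inE pB tr.
  apply/exists_inP; exists p => //; apply/coversP; split; first by rewrite inE pB' orbT.
  (* An added competitor is [(a, b)], which lies weakly above every transversal pair over the two
     leaves; being also below [(u1, v1)], it coincides with it. *)
  exists u1, v1; split=> // u2 v2 /loopless_cupP[/andP[uvS _]|[t' E [_ lt']]] u12 u2x v12 v2y.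
    exact: pmax.
  rewrite pE in tr; have [au1 bv1] := lca_transversal ca cb ax by_ tr u1x v1y.
  have [|E1 E2] := lca_siblings ca cb ab ax by_ E _ u2x v2y.
    by rewrite E; apply: children_transversal.
  rewrite E1 in u12 *; rewrite E2 in v12 *.
  by rewrite pE (ancestor_anti u12 au1) (ancestor_anti v12 bv1).
(* The covering pair is a loop at [s]. As nothing takes over from it, [[set a; b]] is absent from
   the old model and [s] is closest to [t], so [[set a; b]] has been added as a positive pair. *)
move: (sE); rewrite pE => /set2_eq1[E1 E2]; rewrite {}E1 {}E2 in u1x v1y pmax pE.
have st := lca_common ca cb ab ax by_ u1x v1y.
have aNs : ~~ anc a s by apply: contra (child_not_ancestor ca) => /ancestor_trans; apply.
have nS : children T t \notin A :|: B.
  apply: contra aNs; rewrite chE => chS.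
  have : [set a; b] = p.
    by apply: pmax => //; [exact: ancestor_trans st at_|exact: ancestor_trans st bt].
  by rewrite sE => /set2_eq1[-> _]; apply: ancestor_refl.
have et : e t = 2.
  rewrite (@closest_propagates _ _ _ _ eP t s); first by rewrite /loop_label -sE pB.
  split=> //; first by rewrite loop_label_neq0 -sE.
  move=> s'; rewrite loop_label_neq0 => s'S s't.
  have [s's|ss'] := ancestor_total s't st; first exact: s's.
  have : [set s'; s'] = p.
    apply: pmax => //; rewrite ?setUid //.
      exact: ancestor_trans (ancestor_trans s't at_) ax.
    exact: ancestor_trans (ancestor_trans s't bt) by_.
  by rewrite sE => /set2_eq1[-> _]; apply: ancestor_refl.
have tB' : children T t \in loopless B 2.
  by apply/setUP; right; apply: imset_f; rewrite inE et eqxx nS lt.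
apply/exists_inP; exists (children T t) => //; apply/coversP.
split; first by rewrite inE tB' orbT.
(* Since [s] is above [a] and [b], a kept pair below [(a, b)] would already have taken over from the
   loop. *)
exists a, b; split=> // u2 v2 /loopless_cupP[/andP[uvS tr]|[t' E [_ lt']]] au2 u2x bv2 v2y.
  have : [set u2; v2] = p.
    apply: pmax => //; [apply: ancestor_trans au2|apply: ancestor_trans bv2].
      exact: ancestor_trans st at_.
    exact: ancestor_trans st bt.
  by rewrite sE => /set2_eq1[E1 _]; rewrite E1 (negPf aNs) in au2.
have [|-> ->] // := lca_siblings ca cb ab ax by_ E _ u2x v2y.
by rewrite E; apply: children_transversal.
Qed.

Lemma loopless_new_pairs :
  new_pairs A B (loopless A 1) (loopless B 2) \subset
  [set children T u | u in [set v | ~~ leaf T v]].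
Proof.
apply/subsetP => p /setDP[/loopless_cupP[/andP[->//]|[u -> [_ lu]]] _].
by apply: imset_f; rewrite inE.
Qed.

Lemma trivIset_new_pairs : trivIset (new_pairs A B (loopless A 1) (loopless B 2)).
Proof.
apply/trivIsetP => p q /(subsetP loopless_new_pairs)/imsetP[u _ ->].
move=> /(subsetP loopless_new_pairs)/imsetP[v _ ->] uv.
apply/pred0P => x /=; rewrite !in_children; apply/negP.
by move=> /andP[/andP[_ /eqP xu] /andP[_ /eqP xv]]; rewrite -xu -xv eqxx in uv.
Qed.

Lemma card_new_pairs :
  #|new_pairs A B (loopless A 1) (loopless B 2)| <= #|[set v | leaf T v]|.
Proof.
apply: leq_trans (subset_leq_card loopless_new_pairs) _.
exact: leq_trans (leq_imset_card _ _) (ltnW (card_inner_leaves binT)).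
Qed.

End Transformation.

(** * Running times of word RAM programs *)

Fixpoint block (cs : seq command) : command :=
  if cs is c :: cs' then Seq c (block cs') else Skip.

(** A step bound for loop-free programs, the only ones for which [wp] is satisfiable. *)
Fixpoint cost (P : command) : nat :=
  match P with
  | Seq P1 P2 => cost P1 + cost P2
  | If _ P1 P2 => (maxn (cost P1) (cost P2)).+1
  | _ => 1
  end.

(* Loops get no precondition here; they are treated by [terminates_while]. *)
Fixpoint wp (w : nat) (P : command) (Q : state -> Prop) (s : state) : Prop :=
  match P with
  | Skip => Q s
  | Const r k => k < w /\ Q (set_reg s r k)
  | Add r i j => regs s i + regs s j < w /\ Q (set_reg s r (regs s i + regs s j))
  | Sub r i j => Q (set_reg s r (regs s i - regs s j))
  | Read r i => Q (set_reg s r (mem s (regs s i)))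
  | Write i j => Q (set_mem s (regs s i) (regs s j))
  | Seq P1 P2 => wp w P1 (wp w P2 Q) s
  | If b P1 P2 => if eval_test s b then wp w P1 Q s else wp w P2 Q s
  | While _ _ => False
  end.

Definition terminates w P t s (Q : state -> Prop) : Prop :=
  exists n s', [/\ exec w P s n s', n <= t & Q s'].

Lemma wp_terminates w P Q s : wp w P Q s -> terminates w P (cost P) s Q.
Proof.
elim: P Q s => /=.
- by move=> Q s; exists 1, s; split=> //; constructor.
- by move=> r k Q s [kw H]; exists 1, (set_reg s r k); split=> //; constructor.
- move=> r i j Q s [kw H]; exists 1, (set_reg s r (regs s i + regs s j)).
  by split=> //; constructor.
- by move=> r i j Q s H; exists 1, (set_reg s r (regs s i - regs s j)); split=> //; constructor.
- by move=> r i Q s H; exists 1, (set_reg s r (mem s (regs s i))); split=> //; constructor.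
- by move=> i j Q s H; exists 1, (set_mem s (regs s i) (regs s j)); split=> //; constructor.
- move=> P1 IH1 P2 IH2 Q s /IH1[n1 [s1 [e1 l1 /IH2[n2 [s2 [e2 l2 q]]]]]].
  by exists (n1 + n2), s2; split=> //; [apply: ExecSeq e1 e2|rewrite leq_add].
- move=> b P1 IH1 P2 IH2 Q s; case: ifPn => hb.
    move=> /IH1[n [s1 [e1 l1 q]]]; exists n.+1, s1; split=> //; first exact: ExecIfTrue.
    by rewrite ltnS (leq_trans l1) ?leq_maxl.
  move=> /IH2[n [s1 [e1 l1 q]]]; exists n.+1, s1; split=> //; first exact: ExecIfFalse.
  by rewrite ltnS (leq_trans l1) ?leq_maxr.
- by [].
Qed.

Lemma terminates_weaken w P t t' s (Q Q' : state -> Prop) :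
  t <= t' -> (forall s', Q s' -> Q' s') -> terminates w P t s Q -> terminates w P t' s Q'.
Proof.
move=> tt' QQ' [n [s' [e l q]]]; exists n, s'; split=> //; last exact: QQ'.
exact: leq_trans tt'.
Qed.

Lemma terminates_seq w P1 P2 t1 t2 s (Q R : state -> Prop) :
  terminates w P1 t1 s Q -> (forall s', Q s' -> terminates w P2 t2 s' R) ->
  terminates w (Seq P1 P2) (t1 + t2) s R.
Proof.
move=> [n [s1 [e1 l1 q]]] /(_ _ q)[m [s2 [e2 l2 r]]].
by exists (n + m), s2; split=> //; [apply: ExecSeq e1 e2|rewrite leq_add].
Qed.

Lemma terminates_skip w s (Q : state -> Prop) : Q s -> terminates w Skip 1 s Q.
Proof. by move=> q; apply: (@wp_terminates _ Skip). Qed.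

(** [I k] describes the state after [k] rounds and decides the test, so the number of rounds is
    exactly [N]. Each round pays for the body and one test, and the failing test adds the last
    step. *)
Lemma terminates_while w b P (I : nat -> state -> Prop) N s :
    (forall k s, k < N -> I k s -> eval_test s b /\ wp w P (I k.+1) s) ->
    (forall s, I N s -> ~~ eval_test s b) -> I 0 s ->
  terminates w (While b P) (N * (cost P).+1).+1 s (I N).
Proof.
move=> step stop I0.
suff H m k s1 : k + m = N -> I k s1 -> terminates w (While b P) (m * (cost P).+1).+1 s1 (I N).
  exact: H I0.
elim: m k s1 {s I0} => [|m IHm] k s kN Ik.
  rewrite addn0 in kN; subst k; exists 1, s; split=> //.
  by apply: ExecWhileFalse; apply: stop.
have [|tb /wp_terminates[n1 [s1 [e1 l1 I1]]]] := step k s _ Ik; first by lia.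
have [|n2 [s2 [e2 l2 q]]] := IHm k.+1 s1 _ I1; first by lia.
exists (n1 + n2).+1, s2; split=> //; first exact: ExecWhileTrue e1 e2.
by rewrite mulSn; lia.
Qed.

(** * The program and its correctness *)

(* Registers: 0 start of the output, 1 the constant one, 2 the number of nodes,
   3-7 the bases of the arrays holding labels, first children, second children,
   marks and the queue, 8 the constant zero, 9-11 start and end of the negative
   pairs and start of the positive ones (which end where array 3 begins), 13 the
   next free output cell, 14 and 15 loop bounds, 16 a sign, 24 and 25 number and
   header address of the pairs being output. *)

Definition locate_code := block [:: Const 1 1; Read 2 8; Add 9 2 1; Read 10 9; Add 9 9 1;
  Add 10 10 10; Add 10 9 10].

Definition measure_code := block [:: Read 3 10; Add 11 10 1; Add 3 3 3; Add 3 11 3].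

(** Behind the input, which ends at the address in register 3, lie five arrays with one cell per
    node, and then the output, whose first word is the number of nodes. *)
Definition allocate_code := block [:: Add 4 3 2; Add 5 4 2; Add 6 5 2; Add 7 6 2; Add 0 7 2;
  Add 13 0 8; Write 13 2; Add 13 13 1].

Definition init_code := block [:: locate_code; measure_code; allocate_code].

(* Children are stored shifted by one, 0 meaning none. *)
Definition child_code := block [:: Add 16 14 1; Read 17 16; Add 18 4 17; Read 19 18;
  Add 20 5 17; Write 13 17; Add 13 13 1;
  If (TestEq 17 14) (Write 7 14) (If (TestEq 19 8) (Write 18 16) (Write 20 16));
  Add 14 14 1].

(** A loop stores its sign at its node; a pair with equal parents sets the mark of that parent. *)
Definition mark_code := block [:: Read 17 14; Add 14 14 1; Read 18 14; Add 14 14 1;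
  If (TestEq 17 18) (block [:: Add 19 3 17; Write 19 16])
    (block [:: Add 19 17 1; Read 20 19; Add 19 18 1; Read 21 19;
       If (TestEq 20 21) (block [:: Add 19 6 20; Write 19 1]) Skip])].

Definition relabel_code :=
  block [:: If (TestEq 21 8) (Write 20 19) Skip; If (TestEq 23 8) (Write 22 19) Skip].

Definition push_code := block [:: Sub 17 17 1; Add 18 5 16; Read 18 18; Sub 18 18 1;
  Add 19 3 16; Read 19 19; Add 20 3 17; Read 21 20; Add 22 3 18; Read 23 22;
  Write 15 17; Add 15 15 1; Write 15 18; Add 15 15 1; relabel_code].

Definition bfs_code := block [:: Read 16 14; Add 14 14 1; Add 17 4 16; Read 17 17;
  If (TestEq 17 8) Skip push_code].

Definition emit_code i j :=
  block [:: Write 13 i; Add 13 13 1; Write 13 j; Add 13 13 1; Add 24 24 1].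

Definition copy_code := block [:: Read 17 14; Add 14 14 1; Read 18 14; Add 14 14 1;
  If (TestEq 17 18) Skip (emit_code 17 18)].

Definition new_code := block [:: Add 17 3 14; Read 17 17; Add 18 6 14; Read 18 18;
  Add 19 4 14; Read 19 19; Add 20 5 14; Read 20 20; Add 14 14 1;
  If (TestEq 17 16) (If (TestEq 18 8) (If (TestEq 19 8) Skip
    (block [:: Sub 19 19 1; Sub 20 20 1; emit_code 19 20])) Skip) Skip].

Opaque relabel_code.
Opaque push_code.
Opaque emit_code.

Definition mark_loop i j sg := block [::
  block [:: Add 14 i 8; Add 15 j 8; Const 16 sg]; While (TestLt 14 15) mark_code].

(** The length of a list precedes its pairs but is known only after they are written, so a 0 holds
    its place until the final [Write]. *)
Definition emit_loop i j sg := block [::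
  block [:: Add 25 13 8; Write 13 8; Add 13 13 1; Const 24 0; Add 14 i 8; Add 15 j 8];
  While (TestLt 14 15) copy_code;
  block [:: Const 16 sg; Const 14 0];
  While (TestLt 14 2) new_code;
  Write 25 24].

Definition unloop_code := block [:: init_code; While (TestLt 14 2) child_code;
  mark_loop 9 10 1; mark_loop 11 3 2;
  block [:: Add 14 7 8; Add 15 14 1]; While (TestLt 14 15) bfs_code;
  emit_loop 9 10 1; emit_loop 11 3 2].

(* A constant, so that simplification does not alter the cardinal of V. *)
Definition node_count (V : finType) := #|V|.

Arguments update _ _ _ _ /.

(** * Memory layout and registers *)

Section Machine.

Variables (V : finType) (T : rooted_tree V) (sA sB : seq (V * V)).
Local Notation code := (@node_code V).
Local Notation root := (tree_root T).
Local Notation n := (node_count V).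

Definition input_size := n + 3 + 2 * size sA + 2 * size sB.
Local Notation L := input_size.

Lemma code_lt v : code v < n.
Proof. exact: ltn_ord. Qed.

Lemma code_inj : injective code.
Proof. by move=> u v /ord_inj/enum_rank_inj. Qed.

Lemma nth_code v : nth root (enum V) (code v) = v.
Proof. exact: nth_enum_rank. Qed.

Lemma code_nth k : k < n -> code (nth root (enum V) k) = k.
Proof.
move=> kn; rewrite /node_code -(enum_val_nth root (Ordinal kn)) enum_valK //.
Qed.

Definition holds_pairs (m : nat -> nat) a (s : seq (V * V)) :=
  forall i, i < size s ->
    m (a + 2 * i) = code (nth (root, root) s i).1 /\
    m (a + 2 * i + 1) = code (nth (root, root) s i).2.

(** The bound on [size q] keeps the queue out of the output, which comes last because its length is
    not fixed. *)
Record memory (m : nat -> nat) (lab c1 c2 mk : V -> nat) (q : seq V) (out : seq nat) : Prop :=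
  Memory {
  mem_parent : forall v, m (code v + 1) = code (parent T v);
  mem_A : holds_pairs m (n + 2) sA;
  mem_B : holds_pairs m (n + 3 + 2 * size sA) sB;
  mem_lab : forall v, m (L + code v) = lab v;
  mem_c1 : forall v, m (L + n + code v) = c1 v;
  mem_c2 : forall v, m (L + n + n + code v) = c2 v;
  mem_mk : forall v, m (L + n + n + n + code v) = mk v;
  mem_q : forall i, i < size q -> m (L + n + n + n + n + i) = code (nth root q i);
  mem_q_size : size q <= n;
  mem_out : forall i, i < size out -> m (L + n + n + n + n + n + i) = nth 0 out i
}.

Definition upd (f : V -> nat) u x v := if v == u then x else f v.

Lemma updateE f i x j : update f i x j = if j == i then x else f j.
Proof. by []. Qed.

Lemma memory_frame m m' lab c1 c2 mk q out lab' c1' c2' mk' q' out' :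
  memory m lab c1 c2 mk q out -> (forall a, a < L -> m' a = m a) ->
  (forall v, m' (L + code v) = lab' v) ->
  (forall v, m' (L + n + code v) = c1' v) ->
  (forall v, m' (L + n + n + code v) = c2' v) ->
  (forall v, m' (L + n + n + n + code v) = mk' v) ->
  (forall i, i < size q' -> m' (L + n + n + n + n + i) = code (nth root q' i)) ->
  size q' <= n ->
  (forall i, i < size out' -> m' (L + n + n + n + n + n + i) = nth 0 out' i) ->
  memory m' lab' c1' c2' mk' q' out'.
Proof.
move=> M E; split=> //.
- by move=> v; have := code_lt v; move=> lv; rewrite E ?(mem_parent M) // /L; lia.
- by move=> i si; have [<- <-] := mem_A M si; rewrite !E // /L; lia.
- by move=> i si; have [<- <-] := mem_B M si; rewrite !E // /L; lia.
Qed.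

(** Address arithmetic settles every region that the write misses, leaving the one it hits. *)
Ltac region M := apply: (memory_frame M) => [a aL|v|v|v|v|i iq||i iq]; rewrite ?updateE;
  try have lv := code_lt v; try (case: eqP => [|_]; first by lia);
  try by rewrite ?(mem_lab M) ?(mem_c1 M) ?(mem_c2 M) ?(mem_mk M) ?(mem_q M) ?(mem_out M)
                 ?(mem_q_size M).

Section Updates.

Variables (m : nat -> nat) (lab c1 c2 mk : V -> nat) (q : seq V) (out : seq nat).
Hypothesis M : memory m lab c1 c2 mk q out.

Lemma write_lab u x : memory (update m (L + code u) x) (upd lab u x) c1 c2 mk q out.
Proof.
have lu := code_lt u; have Q := mem_q_size M; region M.
rewrite /upd; case: eqP => [E|nE]; case: eqP => // E'; rewrite ?(mem_lab M) //.
- by case: E'; apply: code_inj; lia.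
- by case: nE; rewrite E'.
Qed.

Lemma write_c1 u x : memory (update m (L + n + code u) x) lab (upd c1 u x) c2 mk q out.
Proof.
have lu := code_lt u; have Q := mem_q_size M; region M.
rewrite /upd; case: eqP => [E|nE]; case: eqP => // E'; rewrite ?(mem_c1 M) //.
- by case: E'; apply: code_inj; lia.
- by case: nE; rewrite E'.
Qed.

Lemma write_c2 u x : memory (update m (L + n + n + code u) x) lab c1 (upd c2 u x) mk q out.
Proof.
have lu := code_lt u; have Q := mem_q_size M; region M.
rewrite /upd; case: eqP => [E|nE]; case: eqP => // E'; rewrite ?(mem_c2 M) //.
- by case: E'; apply: code_inj; lia.
- by case: nE; rewrite E'.
Qed.

Lemma write_mk u x : memory (update m (L + n + n + n + code u) x) lab c1 c2 (upd mk u x) q out.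
Proof.
have lu := code_lt u; have Q := mem_q_size M; region M.
rewrite /upd; case: eqP => [E|nE]; case: eqP => // E'; rewrite ?(mem_mk M) //.
- by case: E'; apply: code_inj; lia.
- by case: nE; rewrite E'.
Qed.

Lemma write_q c : size q < n ->
  memory (update m (L + n + n + n + n + size q) (code c)) lab c1 c2 mk (rcons q c) out.
Proof.
move=> qn; region M; last by rewrite size_rcons.
rewrite size_rcons ltnS in iq; rewrite nth_rcons.
have [->|/eqP ne] := eqVneq i (size q); first by rewrite ?eqxx ltnn ?eqxx.
have iq' : i < size q by lia.
by rewrite iq'; case: eqP => [E|_]; [lia|exact: (mem_q M iq')].
Qed.

Lemma write_out x :
  memory (update m (L + n + n + n + n + n + size out) x) lab c1 c2 mk q (rcons out x).
Proof.
have Q := mem_q_size M; region M.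
rewrite size_rcons ltnS in iq; rewrite nth_rcons.
have [->|/eqP ne] := eqVneq i (size out); first by rewrite ?eqxx ltnn ?eqxx.
have iq' : i < size out by lia.
by rewrite iq'; case: eqP => [E|_]; [lia|exact: (mem_out M iq')].
Qed.

End Updates.

Lemma rewrite_out m lab c1 c2 mk q pre x y suf :
  memory m lab c1 c2 mk q (pre ++ x :: suf) ->
  memory (update m (L + n + n + n + n + n + size pre) y) lab c1 c2 mk q (pre ++ y :: suf).
Proof.
move=> M; have Q := mem_q_size M; region M.
have iq' : i < size (pre ++ x :: suf) by move: iq; rewrite !size_cat.
have := mem_out M iq'; rewrite !nth_cat; case: (ltnP i (size pre)) => ip.
  by move=> <-; case: eqP => // E; lia.
case: eqP => [E|nE] /=; first by have -> : i - size pre = 0 by lia.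
by case E : (i - size pre) => [|j] //=; lia.
Qed.

Lemma memory_ext m lab c1 c2 mk q out lab' c1' c2' mk' :
  memory m lab c1 c2 mk q out -> lab =1 lab' -> c1 =1 c1' -> c2 =1 c2' -> mk =1 mk' ->
  memory m lab' c1' c2' mk' q out.
Proof. by case=> *; split=> // v; move: (v) => {}v; congruence. Qed.

Lemma input_size_ge : n + 3 <= L.
Proof. by rewrite /input_size; lia. Qed.

Definition input_list a s :=
  (a, s) = (n + 2, sA) \/ (a, s) = (n + 3 + 2 * size sA, sB).

Lemma input_list_bound a s : input_list a s -> a + 2 * size s <= L.
Proof. by case=> -[-> ->]; rewrite /input_size; lia. Qed.

Lemma memory_input m lab c1 c2 mk q out a s :
  memory m lab c1 c2 mk q out -> input_list a s -> holds_pairs m a s.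
Proof. by move=> M [] [-> ->]; [exact: mem_A M|exact: mem_B M]. Qed.

Variable w : nat.
(** The output starts at most at [6 * L], and its length is kept within [8 * L] during the run, so
    every address stays below [20 * L]. *)
Hypotheses (binT : full_binary T) (wL : 20 * L <= w).

Record constants (s : state) : Prop := Constants {
  reg0 : regs s 0 = L + n + n + n + n + n;
  reg1 : regs s 1 = 1;
  reg2 : regs s 2 = n;
  reg3 : regs s 3 = L;
  reg4 : regs s 4 = L + n;
  reg5 : regs s 5 = L + n + n;
  reg6 : regs s 6 = L + n + n + n;
  reg7 : regs s 7 = L + n + n + n + n;
  reg8 : regs s 8 = 0;
  reg9 : regs s 9 = n + 2;
  reg10 : regs s 10 = n + 2 + 2 * size sA;
  reg11 : regs s 11 = n + 3 + 2 * size sA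
}.

(** * Scan of the parent array *)

Definition kids k u := [seq v <- take k (enum V) | v \in children T u].
Definition kid i k u := nth 0 [seq (code v).+1 | v <- kids k u] i.

Lemma kids_step k u : k < n ->
  let v := nth root (enum V) k in
  kids k.+1 u = if v \in children T u then rcons (kids k u) v else kids k u.
Proof. by move=> kn v; rewrite /kids (take_nth root) -?[size (enum _)]cardT // filter_rcons. Qed.

Lemma size_kids k u : size (kids k u) <= 2.
Proof.
have : uniq (kids k u) by rewrite filter_uniq ?take_uniq ?enum_uniq.
move/card_uniqP <-; apply: leq_trans (_ : #|children T u| <= _).
  by apply: subset_leq_card; apply/subsetP => v; rewrite mem_filter => /andP[].
by rewrite card_children //; case: leaf.
Qed.

Lemma kids_leaf u : leaf T u -> kids n u = [::].
Proof.
move=> /eqP lu; apply/eqP; rewrite -size_eq0 size_filter lu -leqn0 leqNgt -has_count.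
by apply/hasPn => v _; rewrite inE.
Qed.

Lemma kids_inner u : ~~ leaf T u -> exists a b,
  [/\ kids n u = [:: a; b], children T u = [set a; b] & a != b].
Proof.
move=> lu.
have uk : uniq (kids n u) by rewrite filter_uniq ?take_uniq ?enum_uniq.
have mk : kids n u =i children T u.
  by move=> v; rewrite mem_filter take_oversize -?[size (enum _)]cardT // mem_enum andbT.
have : size (kids n u) = 2.
  by rewrite -(card_uniqP uk) (eq_card mk) card_children // lu.
case: (kids n u) uk mk => [|a [|b []]] //= /andP[]; rewrite inE => ab _ mk _.
by exists a, b; split=> //; apply/setP => v; rewrite -mk !inE.
Qed.

(** The scan also copies the parent array to the output and puts the root, recognised as its own
    parent, into the queue. *)
Definition child_inv k s :=
  [/\ constants s, regs s 14 = k, regs s 13 = L + n + n + n + n + n + k.+1 &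
      memory (mem s) (fun=> 0) (kid 0 k) (kid 1 k) (fun=> 0)
        (if root \in take k (enum V) then [:: root] else [::])
        (n :: [seq code (parent T v) | v <- take k (enum V)])].

Lemma child_step k s : k < n -> child_inv k s -> wp w child_code (child_inv k.+1) s.
Proof.
move=> kn [C r14 r13 M].
have [v [vE vk]] : exists v, nth root (enum V) k = v /\ code v = k.
  by exists (nth root (enum V) k); rewrite code_nth.
have nL := input_size_ge.
have tk : take k.+1 (enum V) = rcons (take k (enum V)) v.
  by rewrite (take_nth root) -?[size (enum _)]cardT // vE.
have sk : size (take k (enum V)) = k by rewrite size_takel // -cardT ltnW.
have pl := code_lt (parent T v).
have Mp := mem_parent M v; rewrite vk in Mp.
have Mc := mem_c1 M (parent T v).
have M1 := write_out M (code (parent T v)).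
rewrite /= size_map sk in M1.
have out' : n :: rcons [seq code (parent T v) | v <- take k (enum V)] (code (parent T v)) =
   n :: [seq code (parent T v) | v <- take k.+1 (enum V)] by rewrite tk map_rcons.
rewrite out' in M1.
case: (C) => c0 c1 c2 c3 c4 c5 c6 c7 c8 c9 c10 c11.
rewrite /= !(c0,c1,c2,c3,c4,c5,c6,c7,c8,r13,r14,Mp,Mc) /=.
do 4 (split; first by lia).
have fin s' : constants s' -> regs s' 14 = k + 1 ->
  regs s' 13 = L + n + n + n + n + n + k.+1 + 1 ->
  memory (mem s') (fun=> 0) (kid 0 k.+1) (kid 1 k.+1) (fun=> 0)
        (if root \in take k.+1 (enum V) then [:: root] else [::])
        (n :: [seq code (parent T v) | v <- take k.+1 (enum V)]) -> child_inv k.+1 s'.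
  by move=> *; split=> //; lia.
have vNtk : v \notin take k (enum V).
  have := enum_uniq V; rewrite -{1}(cat_take_drop k.+1 (enum V)) tk cat_uniq rcons_uniq.
  by case/andP=> /andP[].
rewrite -[X in _ == X]vk (inj_eq (code_inj)) parent_fix; case: eqP => [vr|/eqP vr].
  split; first by lia.
  apply: fin => //=; rewrite vr in vNtk.
  have := write_q M1 root; rewrite (negPf vNtk) /= addn0 -vr vk.
  move/(_ (leq_ltn_trans (leq0n k) kn)).
  rewrite tk mem_rcons vr inE eqxx /= => M2.
  by apply: (memory_ext M2) => // u; rewrite /kid kids_step // vE vr in_children eqxx.
have rq : (root \in take k.+1 (enum V)) = (root \in take k (enum V)).
  by rewrite tk mem_rcons inE eq_sym (negPf vr).
have other u : u != parent T v -> kids k.+1 u = kids k u.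
  by rewrite kids_step // vE in_children eq_sym => /negPf->; rewrite andbF.
have same : kids k.+1 (parent T v) = rcons (kids k (parent T v)) v.
  by rewrite kids_step // vE in_children vr eqxx.
(* No node has more than two children, so at most one was stored before [v] and a slot is free. *)
have := size_kids k.+1 (parent T v); rewrite same size_rcons ltnS => szk.
rewrite /kid; case kE : (kids k (parent T v)) szk => [|a [|b l]] //= _.
  split; first by lia.
  apply: fin => //=; rewrite rq.
  apply: (memory_ext (write_c1 M1 (parent T v) (k + 1))) => // u.
    by rewrite /upd /kid; case: eqP => [->|/eqP/other->//]; rewrite same kE /= vk addn1.
  by rewrite /kid; have [->|/other->//] := eqVneq u (parent T v); rewrite same kE.
split; first by lia.
apply: fin => //=; rewrite rq.
apply: (memory_ext (write_c2 M1 (parent T v) (k + 1))) => // u.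
  by rewrite /kid; have [->|/other->//] := eqVneq u (parent T v); rewrite same kE.
by rewrite /upd /kid; case: eqP => [->|/eqP/other->//]; rewrite same kE /= vk addn1.
Qed.

Lemma child_loop s : child_inv 0 s ->
  terminates w (While (TestLt 14 2) child_code) (n * (cost child_code).+1).+1 s (child_inv n).
Proof.
apply: terminates_while => [k {}s kn I|{}s [C r14 _ _] /=]; last by rewrite r14 (reg2 C) ltnn.
split; last exact: child_step.
by case: I => C r14 _ _; rewrite /= r14 (reg2 C).
Qed.

(** * Recording loops and sibling pairs *)

Definition sibling_over u (x : V * V) :=
  [&& x.1 != x.2, parent T x.1 == u & parent T x.2 == u].

Section Mark.

Variables (a : nat) (s : seq (V * V)) (sg : nat).
Variables (lab c1 c2 mk : V -> nat) (q : seq V) (out : seq nat).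
Hypothesis as_in : input_list a s.

Definition mark_lab k v := if (v, v) \in take k s then sg else lab v.
Definition mark_mk k u := if has (sibling_over u) (take k s) then 1 else mk u.

Definition mark_inv k st :=
  [/\ constants st,
      [/\ regs st 13 = L + n + n + n + n + n + size out, regs st 14 = a + 2 * k,
      regs st 15 = a + 2 * size s & regs st 16 = sg] &
      memory (mem st) (mark_lab k) c1 c2 (mark_mk k) q out].

Lemma mark_step k st : k < size s -> mark_inv k st -> wp w mark_code (mark_inv k.+1) st.
Proof.
move=> ks [C [r13 r14 r15 r16] M].
have nL := input_size_ge; have aL := input_list_bound as_in.
have [m1 m2] := memory_input M as_in ks.
have tk : take k.+1 s = rcons (take k s) (nth (root, root) s k) by rewrite (take_nth (root, root)).
case: (nth _ _ _) m1 m2 tk => x y /= m1 m2 tk.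
have fin s' : constants s' -> regs s' 13 = L + n + n + n + n + n + size out ->
  regs s' 14 = a + 2 * k + 1 + 1 -> regs s' 15 = a + 2 * size s -> regs s' 16 = sg ->
  memory (mem s') (mark_lab k.+1) c1 c2 (mark_mk k.+1) q out -> mark_inv k.+1 s'.
  by move=> *; split=> //; split=> //; lia.
have px := mem_parent M x; have py := mem_parent M y.
have := (code_lt x, code_lt y, code_lt (parent T x)); move=> [[lx ly] lpx].
case: (C) => ? r1 ? r3 ? ? r6 ? ? ? ? ?.
rewrite /= !(r1, r3, r6, r14, m1, m2) /=.
do 2 (split; first by lia).
rewrite (inj_eq (code_inj)); case: eqP => [xy|/eqP xy] /=.
  split; first by lia.
  apply: fin => //=; subst y; rewrite r16.
  apply: (memory_ext (write_lab M x sg)) => // v; rewrite /upd /mark_lab /mark_mk tk ?has_rcons.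
    by rewrite mem_rcons inE xpair_eqE andbb; case: eqP.
  by rewrite /sibling_over /= eqxx.
split; first by lia.
rewrite px; split; first by lia.
rewrite py (inj_eq (code_inj)).
have labE : mark_lab k.+1 =1 mark_lab k.
  move=> v; rewrite /mark_lab tk mem_rcons inE xpair_eqE.
  by have [->|//] := eqVneq v x; rewrite (negPf xy).
case: eqP => [pxy|/eqP pxy] /=.
  split; first by lia.
  apply: fin => //=.
  apply: (memory_ext (write_mk M (parent T x) 1)) => // v; rewrite /upd /mark_mk tk has_rcons.
  by rewrite /sibling_over /= xy -pxy andbb /= [_ == v]eq_sym; case: eqP.
apply: fin => //=.
apply: (memory_ext M) => // v; rewrite /mark_mk tk has_rcons /sibling_over /= xy /=.
by have [<-|//] := eqVneq (parent T x) v; rewrite eq_sym (negPf pxy).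
Qed.

Lemma mark_while st : mark_inv 0 st ->
  terminates w (While (TestLt 14 15) mark_code) (size s * (cost mark_code).+1).+1 st
    (mark_inv (size s)).
Proof.
apply: terminates_while => [k {}st kn I|{}st [_ [_ r14 r15 _] _] /=]; last by rewrite r14 r15 ltnn.
split; last exact: mark_step.
by case: I => _ [_ r14 r15 _] _ /=; lia.
Qed.

End Mark.

(** * Breadth-first traversal *)

Definition relabel a b u (e : V -> nat) :=
  let e1 := if e a == 0 then upd e a (e u) else e in
  if e b == 0 then upd e1 b (e u) else e1.

Section Bfs.

Variables (lab mk : V -> nat) (out : seq nat).

(** The first [k] entries of the queue are processed. A label is final as soon as its node is queued
    and untouched before that, so once all nodes are queued the last clause becomes [propagates]. *)
Definition bfs_state (e : V -> nat) (q : seq V) k :=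
  [/\ uniq q, root \in q, k <= size q,
      forall v, v != root -> (v \in q) = (parent T v \in take k q) &
      forall v, e v = if [&& v \in q, lab v == 0 & v != root] then e (parent T v) else lab v].

Definition bfs_inv k st := exists e q,
  [/\ constants st,
      [/\ regs st 13 = L + n + n + n + n + n + size out,
       regs st 14 = L + n + n + n + n + k & regs st 15 = L + n + n + n + n + size q],
      memory (mem st) e (kid 0 n) (kid 1 n) mk q out & bfs_state e q k].

Lemma bfs_full e q k : bfs_state e q k -> size q <= k -> forall v, v \in q.
Proof.
move=> [_ rq _ cl _] qk v; have [d dv] := ubnP (depth T v); elim: d v dv => // d IHd v dv.
have [->//|vr] := eqVneq v root; rewrite cl // take_oversize //; apply: IHd.
have : depth T v != 0 by apply: contraNneq vr => /depth_eq0->.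
by move: dv; rewrite depth_parent; case: depth.
Qed.

(** An exhausted queue contains every node, by induction on the depth, so the traversal cannot stop
    before round [n]. *)
Lemma bfs_size e q k : bfs_state e q k -> k < n -> k < size q.
Proof.
move=> B kn; rewrite ltnNge; apply: contraL kn => qk; rewrite -leqNgt.
apply: (leq_trans _ qk); rewrite /node_count cardT; apply: uniq_leq_size (enum_uniq _) _.
by move=> v _; apply: (bfs_full B qk).
Qed.

Lemma bfs_state_leaf e q k : bfs_state e q k -> k < size q ->
  leaf T (nth root q k) -> bfs_state e q k.+1.
Proof.
move=> [uq rq kq cl eE] kq' /eqP lu; split=> // v vr; rewrite cl //.
rewrite (take_nth root) // mem_rcons inE; case: eqP => // E.
have : v \in children T (nth root q k) by rewrite in_children vr E eqxx.
by rewrite lu inE.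
Qed.

Lemma bfs_state_inner e q k a b : bfs_state e q k -> k < size q ->
  let u := nth root q k in children T u = [set a; b] -> a != b ->
  bfs_state (relabel a b u e) (rcons (rcons q a) b) k.+1.
Proof.
move=> [uq rq kq cl eE] kq' u chE ab.
have uq_ : u \in q by apply: mem_nth.
have uNtk : u \notin take k q.
  have := uq; rewrite -{1}(cat_take_drop k.+1 q) (take_nth root) // cat_uniq rcons_uniq.
  by case/andP=> /andP[].
have [ca cb] : a \in children T u /\ b \in children T u by rewrite chE set21 set22.
(* The queue has no repetitions, so [u] was not processed earlier and its children are not queued
   yet. *)
have new c : c \in children T u -> [/\ c != root, parent T c = u & c \notin q].
  by rewrite in_children => /andP[cr /eqP pc]; split=> //; rewrite cl // pc.
have [ar pa aq] := new _ ca; have [br pb bq] := new _ cb.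
have ea : e a = lab a by rewrite eE (negPf aq).
have eb : e b = lab b by rewrite eE (negPf bq).
have ua : u != a by apply: contraNneq aq => <-.
have ub : u != b by apply: contraNneq bq => <-.
set e2 := relabel a b u e.
have e2E v : e2 v = if (v == a) && (lab a == 0) || (v == b) && (lab b == 0) then e u else e v.
  rewrite /e2 /relabel ea eb; have [->|va] := eqVneq v a.
    by rewrite (negPf ab); do 2 case: ifP => /= _; rewrite /upd ?eqxx ?(negPf ab).
  have [->|vb] := eqVneq v b; last first.
    by do 2 case: ifP => /= _; rewrite /upd ?(negPf va) ?(negPf vb).
  by do 2 case: ifP => /= _; rewrite /upd ?eqxx // eq_sym (negPf ab).
have e2q v : v \in q -> e2 v = e v.
  move=> vq; rewrite e2E.
  have /negPf-> : v != a by apply: contraNneq aq => <-.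
  by have /negPf-> : v != b by apply: contraNneq bq => <-.
split.
- by rewrite !rcons_uniq mem_rcons inE eq_sym (negPf ab) /= aq bq uq.
- by rewrite !(mem_rcons, inE) rq !orbT.
- by rewrite !size_rcons ltnS leqW.
- move=> v vr; rewrite !(mem_rcons, inE) cl // -!cats1 -catA takel_cat //.
  have -> : take k.+1 q = rcons (take k q) u by rewrite (take_nth root).
  rewrite mem_rcons inE; case: (eqVneq (parent T v) u) => [pv|pv] /=.
    have : v \in children T u by rewrite in_children vr pv eqxx.
    by rewrite chE !inE => /orP[]/eqP->; rewrite eqxx ?orbT.
  have /negPf-> : v != a by apply: contraNneq pv => ->; rewrite pa.
  by have /negPf-> : v != b by apply: contraNneq pv => ->; rewrite pb.
- move=> v; have [vq|vq] := boolP (v \in q).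
    rewrite e2q // eE vq !(mem_rcons, inE) vq !orbT /=.
    (* The parent of a queued node other than the root has been processed, hence is itself queued
       and keeps its label. *)
    case: ifP => // /andP[_ vr]; rewrite e2q //.
    by apply: (mem_take (n0 := k)); rewrite -cl.
  rewrite e2E !(mem_rcons, inE) (negPf vq) orbF.
  have [->|va] := eqVneq v a; first by rewrite ar pa (negPf ab) !orbF /= !andbT ea e2q.
  have [->|vb] := eqVneq v b; first by rewrite br pb /= !andbT eb e2q.
  by rewrite /= eE (negPf vq).
Qed.

End Bfs.

Lemma push_wp st e mk q out a b u (Q : state -> Prop) :
  constants st -> regs st 15 = L + n + n + n + n + size q -> regs st 16 = code u ->
  regs st 17 = (code a).+1 -> memory (mem st) e (kid 0 n) (kid 1 n) mk q out ->
  kid 1 n u = (code b).+1 -> (size q).+1 < n ->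
  (forall s', constants s' -> regs s' 13 = regs st 13 -> regs s' 14 = regs st 14 ->
    regs s' 15 = L + n + n + n + n + size q + 1 + 1 ->
    memory (mem s') (relabel a b u e) (kid 0 n) (kid 1 n) mk (rcons (rcons q a) b) out -> Q s') ->
  wp w push_code Q st.
Proof.
move=> C r15 r16 r17 M c2E qn HQ.
have nL := input_size_ge.
have la := code_lt a; have lb := code_lt b; have lu := code_lt u.
have ml := mem_lab M u; have mc2 := mem_c2 M u; rewrite c2E in mc2.
have ma := mem_lab M a; have mb := mem_lab M b.
have M1 := write_q M a (ltnW qn).
have := write_q M1 b; rewrite size_rcons => /(_ qn); rewrite addnS -addn1 => M2.
case: (C) => ? r1 ? r3 r4 r5 ? ? r8 ? ? ?.
Transparent push_code.
rewrite /push_code /= !(r1, r3, r5, r15, r16, r17) /= !subn1 /= !mc2 /= !(ma, mb, ml).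
do 6 (split; first by lia).
Transparent relabel_code.
rewrite /relabel_code /= !r8; rewrite /relabel in HQ.
case: (e a == 0) HQ; case: (e b == 0) => HQ /=; apply: HQ => //=.
- exact: (write_lab (write_lab M2 _ _)).
- exact: (write_lab M2).
- exact: (write_lab M2).
Qed.
Opaque push_code relabel_code.

Lemma bfs_step lab mk out k st : k < n -> bfs_inv lab mk out k st ->
  eval_test st (TestLt 14 15) /\ wp w bfs_code (bfs_inv lab mk out k.+1) st.
Proof.
move=> kn [e [q [C [r13 r14 r15] M B]]].
have kq := bfs_size B kn; split; first by rewrite /= r14 r15; lia.
have nL := input_size_ge.
have mu := mem_q M kq; have leafP := bfs_state_leaf B kq; have innP := bfs_state_inner B kq.
move: (nth root q k) mu leafP innP => u mu leafP innP.
have lu := code_lt u; have mc1 := mem_c1 M u; have mc2 := mem_c2 M u; have ml := mem_lab M u.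
case: (C) => ? r1 ? r3 r4 r5 ? ? r8 ? ? ?.
rewrite /= !(r1, r3, r4, r5, r8, r13, r14, r15, mu, mc1) /=.
do 2 (split; first by lia).
have [lf|/kids_inner] := boolP (leaf T u).
  rewrite /kid kids_leaf //=; exists e, q; split=> //; last exact: leafP.
  by split=> //=; lia.
case=> // a [b [kE chE ab]].
have c1E : kid 0 n u = (code a).+1 by rewrite /kid kE.
have c2E : kid 1 n u = (code b).+1 by rewrite /kid kE.
have B' := innP _ _ chE ab.
(* The queue extended by both children is still free of repetitions, so it fits into its array. *)
have qn : (size q).+1 < n.
  have [uq _ _ _ _] := B'.
  have : #|rcons (rcons q a) b| <= #|V| := max_card _; rewrite (card_uniqP uq) !size_rcons.
  by rewrite /node_count.
rewrite c1E /=.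
apply: (push_wp (e := e) (mk := mk) (q := q) (out := out) (a := a) (b := b) (u := u)) => //=.
move=> s' C' r13' r14' r15' M'.
exists (relabel a b u e), (rcons (rcons q a) b); split=> //; split=> //; try by lia.
by rewrite !size_rcons r15'; lia.
Qed.

Lemma bfs_while lab mk out st : bfs_inv lab mk out 0 st ->
  terminates w (While (TestLt 14 15) bfs_code) (n * (cost bfs_code).+1).+1 st
    (bfs_inv lab mk out n).
Proof.
apply: terminates_while => [k {}st|{}st [e [q [C [r13 r14 r15] M B]]]]; first exact: bfs_step.
by rewrite /= r14 r15 -leqNgt leq_add2l (mem_q_size M).
Qed.

(** * Output of the pair lists *)

Definition pair_codes (E : seq (V * V)) := flatten [seq [:: code x.1; code x.2] | x <- E].

Lemma size_pair_codes E : size (pair_codes E) = 2 * size E.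
Proof. by elim: E => // x E /= ->; rewrite mulnS. Qed.

Lemma pair_codes_rcons E x :
  pair_codes (rcons E x) = rcons (rcons (pair_codes E) (code x.1)) (code x.2).
Proof. by rewrite /pair_codes map_rcons flatten_rcons -!cats1 -catA. Qed.

Section Emit.

Variables (lab mk : V -> nat) (q : seq V) (pre : seq nat).

Definition emitting E st :=
  [/\ constants st, regs st 13 = L + n + n + n + n + n + size pre + 1 + 2 * size E,
      regs st 24 = size E, regs st 25 = L + n + n + n + n + n + size pre &
      memory (mem st) lab (kid 0 n) (kid 1 n) mk q (pre ++ 0 :: pair_codes E)].

Lemma emit_wp E st i j x (Q : state -> Prop) :
  emitting E st -> i != 13 -> j != 13 ->
  regs st i = code x.1 -> regs st j = code x.2 -> size pre + 2 * size E <= 8 * L ->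
  (forall st', emitting (rcons E x) st' ->
     (forall r, r != 13 -> r != 24 -> regs st' r = regs st r) -> Q st') ->
  wp w (emit_code i j) Q st.
Proof.
move=> [C r13 r24 r25 M] /negPf i13 /negPf j13 ri rj bd HQ.
have nL := input_size_ge.
case: (C) => ? r1 ? ? ? ? ? ? ? ? ? ?.
Transparent emit_code.
rewrite /emit_code /= !(i13, j13, r1, r13, r24, ri, rj) /=.
do 3 (split; first by lia).
apply: HQ => [|r /negPf h13 /negPf h24] /=; last by rewrite ?h13 ?h24 ?h13.
split=> //=; rewrite ?size_rcons; try by lia.
have M1 := write_out M (code x.1); have := write_out M1 (code x.2).
rewrite !size_rcons !size_cat /= size_pair_codes !rcons_cat !rcons_cons -pair_codes_rcons.
rewrite (_ : _ + (_ + (_).+1) = L + n + n + n + n + n + size pre + 1 + 2 * size E); last by lia.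
rewrite (_ : _ + (_ + (_).+1).+1 = L + n + n + n + n + n + size pre + 1 + 2 * size E + 1) //.
by lia.
Qed.
Opaque emit_code.

Section Copy.

Variables (a : nat) (s : seq (V * V)).
Hypotheses (as_in : input_list a s) (pre_bound : size pre <= 5 * L).

Definition proper (x : V * V) := x.1 != x.2.

Definition copy_inv k st :=
  [/\ emitting [seq x <- take k s | proper x] st, regs st 14 = a + 2 * k &
      regs st 15 = a + 2 * size s].

Lemma copy_step k st : k < size s -> copy_inv k st -> wp w copy_code (copy_inv k.+1) st.
Proof.
move=> ks [I r14 r15]; have [C r13 r24 r25 M] := I.
have nL := input_size_ge; have aL := input_list_bound as_in.
have [m1 m2] := memory_input M as_in ks.
have := take_nth (root, root) ks.
case: (nth _ _ _) m1 m2 => x y /= m1 m2 tk.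
rewrite /copy_inv tk filter_rcons.
case: (C) => ? r1 ? ? ? ? ? ? ? ? ? ?.
rewrite /= !(r1, r14, m1, m2) /=.
do 2 (split; first by lia).
rewrite (inj_eq (code_inj)) /proper /=; case: eqP => [xy|/eqP xy] /=.
  by split=> //; rewrite /=; lia.
have szf : size [seq x <- take k s | proper x] <= k.
  by rewrite size_filter (leq_trans (count_size _ _)) // size_take_min geq_minl.
apply: (emit_wp (E := [seq x <- take k s | proper x]) (x := (x, y))) => //=; first by lia.
by move=> st' I' H; split=> //; rewrite H //=; lia.
Qed.

Lemma copy_while st : copy_inv 0 st ->
  terminates w (While (TestLt 14 15) copy_code) (size s * (cost copy_code).+1).+1 st
    (copy_inv (size s)).
Proof.
apply: terminates_while => [k {}st kn I|{}st [_ r14 r15] /=]; last by rewrite r14 r15 ltnn.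
split; last exact: copy_step.
by case: I => _ r14 r15 /=; lia.
Qed.

End Copy.

Section New.

Variables (E0 : seq (V * V)) (sg : nat).
Hypothesis pre_bound : size pre + 2 * size E0 <= 6 * L.

Definition kid_pair u := (nth root (kids n u) 0, nth root (kids n u) 1).

Definition splits u := [&& lab u == sg, mk u == 0 & ~~ leaf T u].

Definition new_inv k st :=
  [/\ emitting (E0 ++ [seq kid_pair u | u <- take k (enum V) & splits u]) st,
      regs st 14 = k & regs st 16 = sg].

Lemma new_step k st : k < n -> new_inv k st -> wp w new_code (new_inv k.+1) st.
Proof.
move=> kn [I r14 r16]; have [C r13 r24 r25 M] := I.
have [u [uE uk]] : exists u, nth root (enum V) k = u /\ code u = k.
  by exists (nth root (enum V) k); rewrite code_nth.
have nL := input_size_ge.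
have tk : take k.+1 (enum V) = rcons (take k (enum V)) u.
  by rewrite (take_nth root) -?[size (enum _)]cardT // uE.
rewrite /new_inv tk filter_rcons.
have := (mem_lab M u, mem_mk M u, mem_c1 M u, mem_c2 M u); rewrite uk => -[[[ml mm] m1] m2].
case: (C) => ? r1 ? r3 r4 r5 r6 ? r8 ? ? ?.
rewrite /= !(r1, r3, r4, r5, r6, r8, r14, r16, ml, mm, m1, m2) /=.
do 5 (split; first by lia).
have [lf|/kids_inner] := boolP (leaf T u).
  have -> : splits u = false by rewrite /splits lf !andbF.
  rewrite /kid kids_leaf //=.
  by do 2 (case: ifP => _; last by split=> //=; lia); split=> //=; lia.
case=> // a [b [kE chE ab]].
have lu : leaf T u = false by rewrite /leaf chE -cards_eq0 cards2.
have c1E : kid 0 n u = (code a).+1 by rewrite /kid kE.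
have c2E : kid 1 n u = (code b).+1 by rewrite /kid kE.
rewrite c1E c2E /= !subn1 /splits lu andbT /=.
case: (lab u == sg) => /=; last by split=> //=; lia.
case: (mk u == 0) => /=; last by split=> //=; lia.
set E := E0 ++ _ in I r13 r24 M.
have szE : size E <= size E0 + n.
  rewrite size_cat leq_add2l size_map size_filter (leq_trans (count_size _ _)) //.
  by rewrite size_take_min (leq_trans (geq_minl _ _)) // ltnW.
apply: (emit_wp (E := E) (x := kid_pair u)) => //=.
- by rewrite kE.
- by rewrite kE.
- by lia.
move=> st' I' H; split; last 2 first.
- by rewrite H //=; lia.
- by rewrite H.
by rewrite map_rcons -rcons_cat.
Qed.

Lemma new_while st : new_inv 0 st ->
  terminates w (While (TestLt 14 2) new_code) (n * (cost new_code).+1).+1 st (new_inv n).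
Proof.
apply: terminates_while => [k {}st kn I|{}st [[C _ _ _ _] r14 _] /=]; last first.
  by rewrite r14 (reg2 C) ltnn.
split; last exact: new_step.
by case: I => -[C _ _ _ _] r14 _ /=; rewrite r14 (reg2 C).
Qed.

End New.

End Emit.

Definition input_regs i j a (s : seq (V * V)) :=
  (i, j, a, s) = (9, 10, n + 2, sA) \/ (i, j, a, s) = (11, 3, n + 3 + 2 * size sA, sB).

Lemma input_regs_list i j a s : input_regs i j a s -> input_list a s.
Proof. by case=> -[_ _ -> ->]; [left|right]. Qed.

Lemma mark_prologue i j a s sg lab c1 c2 mk q out st :
  input_regs i j a s -> sg < 3 -> constants st ->
  regs st 13 = L + n + n + n + n + n + size out ->
  memory (mem st) lab c1 c2 mk q out ->
  wp w (block [:: Add 14 i 8; Add 15 j 8; Const 16 sg])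
    (mark_inv a s sg lab c1 c2 mk q out 0) st.
Proof.
move=> h sg3 C r13 M; have nL := input_size_ge; have LE : L = _ := erefl.
rewrite {2}/input_size in LE; case: (C) => ? ? ? r3 ? ? ? ? r8 r9 r10 r11.
by case: h => -[-> -> -> ->]; rewrite /= !(r3, r8, r9, r10, r11, addn0);
  do 3 (split; first by lia); (split=> //; first by split=> //=; lia);
  apply: (memory_ext M) => // v; rewrite /mark_lab /mark_mk take0.
Qed.

Lemma mark_loop_terminates i j a s sg lab c1 c2 mk q out st :
  input_regs i j a s -> sg < 3 -> constants st ->
  regs st 13 = L + n + n + n + n + n + size out ->
  memory (mem st) lab c1 c2 mk q out ->
  terminates w (mark_loop i j sg) (20 * L) st (fun st' =>
    [/\ constants st', regs st' 13 = L + n + n + n + n + n + size out &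
        memory (mem st') (fun v => if (v, v) \in s then sg else lab v) c1 c2
          (fun u => if has (sibling_over u) s then 1 else mk u) q out]).
Proof.
move=> h sg3 C r13 M; have ls := input_regs_list h; have sL := input_list_bound ls.
have nL := input_size_ge.
have := terminates_seq (wp_terminates (mark_prologue h sg3 C r13 M)) (fun st' I =>
  terminates_seq (mark_while ls I) (fun st' => @terminates_skip w st' _)).
apply: terminates_weaken => [|st' [C' [r13' _ _ _] M']]; first by rewrite /=; lia.
by split=> //; apply: (memory_ext M') => // v; rewrite /mark_lab /mark_mk take_size.
Qed.

Lemma emit_prologue i j a s lab mk q pre st :
  input_regs i j a s -> constants st -> size pre <= 5 * L ->
  regs st 13 = L + n + n + n + n + n + size pre ->
  memory (mem st) lab (kid 0 n) (kid 1 n) mk q pre ->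
  wp w (block [:: Add 25 13 8; Write 13 8; Add 13 13 1; Const 24 0; Add 14 i 8; Add 15 j 8])
    (copy_inv lab mk q pre a s 0) st.
Proof.
move=> h C bd r13 M; have nL := input_size_ge; have LE : L = _ := erefl.
rewrite {2}/input_size in LE; case: (C) => ? r1 ? r3 ? ? ? ? r8 r9 r10 r11.
have M1 := write_out M 0; rewrite -cats1 in M1.
by case: h => -[-> -> -> ->]; rewrite /= !(r1, r3, r8, r9, r10, r11, r13, addn0);
  do 5 (split; first by lia); rewrite /copy_inv take0; split; rewrite /=; try lia;
  split=> //=; lia.
Qed.

Definition emitted (s : seq (V * V)) lab mk sg :=
  [seq x <- s | proper x] ++ [seq kid_pair u | u <- enum V & splits lab mk sg u].

Lemma size_emitted s lab mk sg : size (emitted s lab mk sg) <= size s + n.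
Proof.
rewrite size_cat size_map !size_filter leq_add ?count_size //.
by rewrite (leq_trans (count_size _ _)) // /node_count cardT.
Qed.

Lemma emit_loop_terminates i j a s sg lab mk q pre st :
  input_regs i j a s -> sg < 3 -> constants st -> size pre <= 5 * L ->
  regs st 13 = L + n + n + n + n + n + size pre ->
  memory (mem st) lab (kid 0 n) (kid 1 n) mk q pre ->
  terminates w (emit_loop i j sg) (50 * L) st (fun st' =>
    let out := pre ++ pairs_code (emitted s lab mk sg) in
    [/\ constants st', regs st' 13 = L + n + n + n + n + n + size out &
        memory (mem st') lab (kid 0 n) (kid 1 n) mk q out]).
Proof.
move=> h sg3 C bd r13 M; have ls := input_regs_list h; have sL := input_list_bound ls.
have nL := input_size_ge.
set E0 := [seq x <- s | proper x].
have szE0 : size E0 <= size s by rewrite size_filter count_size.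
have mid st1 : copy_inv lab mk q pre a s (size s) st1 ->
    wp w (block [:: Const 16 sg; Const 14 0]) (new_inv lab mk q pre E0 sg 0) st1.
  case=> I _ _; rewrite take_size -/E0 in I; case: I => -[*].
  by rewrite /=; do 2 (split; first by lia); split=> //=; rewrite take0 cats0; split.
have fin st1 : new_inv lab mk q pre E0 sg n st1 -> wp w (Write 25 24) (fun st' =>
    let out := pre ++ pairs_code (emitted s lab mk sg) in
    [/\ constants st', regs st' 13 = L + n + n + n + n + n + size out &
        memory (mem st') lab (kid 0 n) (kid 1 n) mk q out]) st1.
  case=> I _ _; rewrite take_oversize -?[size (enum _)]cardT // -/(emitted _ _ _ _) in I.
  case: I => C1 r13_ r24 r25 M1; rewrite /= r24 r25; split; first by case: C1.
    by rewrite r13_ size_cat /= size_pair_codes; lia.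
  exact: (rewrite_out _ M1).
have bdE0 : size pre + 2 * size E0 <= 6 * L by lia.
have := terminates_seq (wp_terminates (emit_prologue h C bd r13 M)) (fun st1 I1 =>
  terminates_seq (copy_while ls bd I1) (fun st2 I2 =>
  terminates_seq (wp_terminates (mid _ I2)) (fun st3 I3 =>
  terminates_seq (new_while bdE0 I3) (fun st4 I4 =>
  terminates_seq (wp_terminates (fin _ I4)) (fun st5 => @terminates_skip w st5 _))))).
apply: terminates_weaken => //.
have -> : cost copy_code = 12 by [].
have -> : cost new_code = 22 by [].
rewrite /=; lia.
Qed.

(** * The input and the complete run *)

Definition input_code := n :: [seq code (parent T v) | v <- enum V] ++
  pairs_code sA ++ pairs_code sB.

Lemma size_pairs_code (E : seq (V * V)) : size (pairs_code E) = (2 * size E).+1.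
Proof. by rewrite /= -size_pair_codes. Qed.

Lemma size_parents : size [seq code (parent T v) | v <- enum V] = n.
Proof. by rewrite size_map -[size (enum _)]cardT. Qed.

Lemma size_input_code : size input_code = L.
Proof.
by rewrite /input_code -cat1s !size_cat size_parents !size_pairs_code /= /input_size; lia.
Qed.

Lemma nth_pair_codes E i : i < size E ->
  nth 0 (pair_codes E) (2 * i) = code (nth (root, root) E i).1 /\
  nth 0 (pair_codes E) (2 * i + 1) = code (nth (root, root) E i).2.
Proof.
elim: E i => // x E IHE [|i] ; first by [].
rewrite ltnS => /IHE[<- <-]; by rewrite mulnS !addSn.
Qed.

Lemma nth_input_A i : nth 0 input_code (n + 1 + i) = nth 0 (pairs_code sA ++ pairs_code sB) i.
Proof. by rewrite addn1 addSn /= nth_cat size_parents ltnNge leq_addr addKn. Qed.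

Lemma nth_input_B i :
  nth 0 input_code (n + 2 + 2 * size sA + i) = nth 0 (pairs_code sB) i.
Proof.
rewrite (_ : _ + _ + i = n + 1 + ((2 * size sA).+1 + i)); last by lia.
by rewrite nth_input_A nth_cat size_pairs_code ltnNge leq_addr addKn.
Qed.

Lemma input_memory :
  memory (fun a => nth 0 input_code a) (fun=> 0) (fun=> 0) (fun=> 0) (fun=> 0) [::] [::].
Proof.
(* Memory behind the input reads as the default 0 of [nth], so the arrays start blank without being
   cleared. *)
have def a : L <= a -> nth 0 input_code a = 0 by move=> La; rewrite nth_default ?size_input_code.
split=> // [v|i ik|i ik|v|v|v|v]; try by rewrite def //; lia.
- have lv := code_lt v; rewrite addn1 /= nth_cat size_parents lv (nth_map root) ?nth_code //.
  by rewrite -[size (enum _)]cardT.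
- have [<- <-] := nth_pair_codes ik.
  rewrite (_ : n + 2 + 2 * i = n + 1 + (2 * i).+1); last by lia.
  rewrite (_ : n + 1 + (2 * i).+1 + 1 = n + 1 + (2 * i + 1).+1); last by lia.
  rewrite !nth_input_A !nth_cat size_pairs_code !ltnS.
  have [-> ->] : 2 * i < 2 * size sA /\ 2 * i + 1 < 2 * size sA by lia.
  by [].
- have [<- <-] := nth_pair_codes ik.
  rewrite (_ : n + 3 + 2 * size sA + 2 * i = n + 2 + 2 * size sA + (2 * i).+1); last by lia.
  rewrite (_ : _ + (2 * i).+1 + 1 = n + 2 + 2 * size sA + (2 * i + 1).+1); last by lia.
  by rewrite !nth_input_B.
Qed.

Definition located st :=
  [/\ [/\ regs st 1 = 1, regs st 2 = n, regs st 8 = 0, regs st 9 = n + 2 &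
      regs st 10 = n + 2 + 2 * size sA], regs st 14 = 0 &
      mem st = fun a => nth 0 input_code a].

Lemma locate_wp : wp w locate_code located (input_state input_code).
Proof.
have nL := input_size_ge; have LE : L = _ := erefl; rewrite {2}/input_size in LE.
have e0 : nth 0 input_code 0 = n by [].
have e1 : nth 0 input_code (n + 1) = size sA by rewrite -[n + 1]addn0 nth_input_A.
rewrite /located; move: input_code e0 e1 => l e0 e1.
rewrite /= !(e0, e1) /=; do 5 (split; first by lia).
by split=> //=; split=> //=; lia.
Qed.

Lemma measure_wp st : located st ->
  wp w measure_code (fun st' =>
    [/\ located st', regs st' 3 = L & regs st' 11 = n + 3 + 2 * size sA]) st.
Proof.
have nL := input_size_ge; have LE : L = _ := erefl; rewrite {2}/input_size in LE.
have e2 : nth 0 input_code (n + 2 + 2 * size sA) = size sB.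
  by rewrite -[n + 2 + _]addn0 nth_input_B.
rewrite /located; move: input_code e2 => l e2 [[r1 r2 r8 r9 r10] r14 mE].
rewrite /= !(r1, r10, mE, e2) /=; do 3 (split; first by lia).
by split=> //=; lia.
Qed.

Lemma allocate_wp st :
    [/\ located st, regs st 3 = L & regs st 11 = n + 3 + 2 * size sA] ->
  wp w allocate_code (child_inv 0) st.
Proof.
have nL := input_size_ge; have M1 := write_out input_memory n; rewrite addn0 in M1.
rewrite /located; move: input_code M1 => l M1 [[[r1 r2 r8 r9 r10] r14 mE] r3 r11].
rewrite /= !(r1, r2, r3, r8, mE, addn0) /=; do 7 (split; first by lia).
split=> //=.
rewrite mE take0; apply: (memory_ext M1) => // v; rewrite /kid /kids take0 //.
Qed.

Lemma init_terminates :
  terminates w init_code 23 (input_state input_code) (child_inv 0).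
Proof.
exact: (terminates_seq (wp_terminates locate_wp) (fun _ I1 =>
  terminates_seq (wp_terminates (measure_wp I1)) (fun _ I2 =>
  terminates_seq (wp_terminates (allocate_wp I2)) (fun s => @terminates_skip w s _)))).
Qed.

Definition loop_lab v := if (v, v) \in sB then 2 else if (v, v) \in sA then 1 else 0.
Definition sibling_mark u :=
  if has (sibling_over u) sB then 1 else if has (sibling_over u) sA then 1 else 0.

Definition output_code e := n :: [seq code (parent T v) | v <- enum V] ++
  pairs_code (emitted sA e sibling_mark 1) ++ pairs_code (emitted sB e sibling_mark 2).

Lemma bfs_prologue out st : constants st -> regs st 13 = L + n + n + n + n + n + size out ->
  memory (mem st) loop_lab (kid 0 n) (kid 1 n) sibling_mark [:: root] out ->
  wp w (block [:: Add 14 7 8; Add 15 14 1]) (bfs_inv loop_lab sibling_mark out 0) st.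
Proof.
move=> C r13 M; have nL := input_size_ge.
case: (C) => ? r1 ? ? ? ? ? r7 r8 ? ? ?.
rewrite /= !(r1, r7, r8) /=; do 2 (split; first by lia).
exists loop_lab, [:: root]; split=> //=.
  by split=> //=; lia.
split=> //= [|v vr|v]; first by rewrite mem_seq1.
  by rewrite mem_seq1 (negPf vr).
by rewrite mem_seq1; case: eqP => //=; rewrite andbF.
Qed.

(** The phases add up to [140 * L + 40 * n + 29] steps; 500 is a generous round bound. *)
Lemma unloop_terminates : terminates w unloop_code (500 * L) (input_state input_code)
  (fun st => exists2 e, propagates T loop_lab e & outputs st (output_code e)).
Proof.
have nL := input_size_ge.
set pre := n :: [seq code (parent T v) | v <- enum V].
have szpre : size pre = n.+1 by rewrite /= size_parents.
have inA : input_regs 9 10 (n + 2) sA by left.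
have inB : input_regs 11 3 (n + 3 + 2 * size sA) sB by right.
have sAL := input_list_bound (input_regs_list inA).
have sBL := input_list_bound (input_regs_list inB).
have fullE : take n (enum V) = enum V by rewrite take_oversize // -[size (enum _)]cardT.
have P1 := init_terminates.
pose Q2 st := [/\ constants st, regs st 13 = L + n + n + n + n + n + size pre &
  memory (mem st) (fun=> 0) (kid 0 n) (kid 1 n) (fun=> 0) [:: root] pre].
have P2 st : child_inv 0 st -> terminates w (While (TestLt 14 2) child_code)
    (n * (cost child_code).+1).+1 st Q2.
  move=> I; apply: terminates_weaken (child_loop I) => // st' [C r14 r13 M].
  by rewrite fullE mem_enum -/pre in M; split=> //; rewrite r13 szpre.
pose Q3 st := [/\ constants st, regs st 13 = L + n + n + n + n + n + size pre &
  memory (mem st) (fun v => if (v, v) \in sA then 1 else 0) (kid 0 n) (kid 1 n)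
   (fun u => if has (sibling_over u) sA then 1 else 0) [:: root] pre].
have P3 st : Q2 st -> terminates w (mark_loop 9 10 1) (20 * L) st Q3.
  by case=> C r13 M; apply: (mark_loop_terminates inA _ C r13 M).
pose Q4 st := [/\ constants st, regs st 13 = L + n + n + n + n + n + size pre &
  memory (mem st) loop_lab (kid 0 n) (kid 1 n) sibling_mark [:: root] pre].
have P4 st : Q3 st -> terminates w (mark_loop 11 3 2) (20 * L) st Q4.
  by case=> C r13 M; apply: (mark_loop_terminates inB _ C r13 M).
have P5 st : Q4 st -> terminates w (block [:: Add 14 7 8; Add 15 14 1]) 3 st
    (bfs_inv loop_lab sibling_mark pre 0).
  by case=> C r13 M; apply: (wp_terminates (bfs_prologue C r13 M)).
pose Q6 out st := exists e q, [/\ propagates T loop_lab e, constants st,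
  regs st 13 = L + n + n + n + n + n + size (out e) &
  memory (mem st) e (kid 0 n) (kid 1 n) sibling_mark q (out e)].
have P6 st : bfs_inv loop_lab sibling_mark pre 0 st ->
    terminates w (While (TestLt 14 15) bfs_code) (n * (cost bfs_code).+1).+1 st
      (Q6 (fun=> pre)).
  move=> I; apply: terminates_weaken (bfs_while I) => // st'.
  case=> e [q [C [r13 _ _] M B]]; exists e, q; split=> // v.
  have [_ _ _ _ ->] := B; rewrite (bfs_full B) //; exact: mem_q_size M.
pose out7 e := pre ++ pairs_code (emitted sA e sibling_mark 1).
have P7 st : Q6 (fun=> pre) st -> terminates w (emit_loop 9 10 1) (50 * L) st (Q6 out7).
  case=> e [q [eP C r13 M]].
  have bd : size pre <= 5 * L by lia.
  have := emit_loop_terminates inA (isT : 1 < 3) C bd r13 M.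
  by apply: terminates_weaken => // st' [C' r13' M']; exists e, q.
have P8 st : Q6 out7 st -> terminates w (emit_loop 11 3 2) (50 * L) st (Q6 output_code).
  case=> e [q [eP C r13 M]].
  have bd : size (out7 e) <= 5 * L.
    rewrite size_cat szpre size_pairs_code.
    by have := size_emitted sA e sibling_mark 1; lia.
  have := emit_loop_terminates inB (isT : 2 < 3) C bd r13 M.
  by apply: terminates_weaken => // st' [C' r13' M']; exists e, q; rewrite /output_code catA.
have := terminates_seq P1 (fun st1 I1 => terminates_seq (P2 _ I1) (fun st2 I2 =>
  terminates_seq (P3 _ I2) (fun st3 I3 => terminates_seq (P4 _ I3) (fun st4 I4 =>
  terminates_seq (P5 _ I4) (fun st5 I5 => terminates_seq (P6 _ I5) (fun st6 I6 =>
  terminates_seq (P7 _ I6) (fun st7 I7 => terminates_seq (P8 _ I7) (fun st8 =>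
  @terminates_skip w st8 _)))))))).
apply: terminates_weaken => [|st [e [q [eP C _ M]]]].
  have [-> ->] : cost child_code = 12 /\ cost bfs_code = 26 by [].
  lia.
exists e => // i il; rewrite (reg0 C); exact: (mem_out M il).
Qed.

End Machine.

(** * Decoding the output *)

Section ListedPairs.

Variables (V : finType) (T : rooted_tree V) (A B : {set {set V}}) (sA sB : seq (V * V)).
Hypothesis modelAB : signed_tree_model_with_loops T A B.
Hypotheses (lA : lists_pairs sA A) (lB : lists_pairs sB B).
Let binT : full_binary T. Proof. by case: modelAB. Qed.

Let pair_set (x : V * V) : {set V} := [set x.1; x.2].

Lemma lists_pairsP s (S : {set {set V}}) : lists_pairs s S ->
  uniq (map pair_set s) /\ map pair_set s =i S.
Proof.
move=> ls; split; first by rewrite (perm_uniq ls) enum_uniq.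
by move=> p; rewrite (perm_mem ls) mem_enum.
Qed.

Lemma listed_loop s (S : {set {set V}}) v : lists_pairs s S ->
  ((v, v) \in s) = ([set v] \in S).
Proof.
case/lists_pairsP=> _ <-; apply/idP/mapP => [vs|[[x y] xs /= E]].
  by exists (v, v); rewrite /pair_set /= ?setUid.
by case: (set2_eq1 (esym E)) xs => /= -> ->.
Qed.

Lemma loop_labE : loop_lab sA sB =1 loop_label A B.
Proof. by move=> v; rewrite /loop_lab !(listed_loop _ lA) !(listed_loop _ lB). Qed.

Lemma listed_pair s (S : {set {set V}}) x : lists_pairs s S -> x \in s -> pair_set x \in S.
Proof. by case/lists_pairsP=> _ <- xs; apply: map_f. Qed.

(** This lets the program recognise the pairs to keep by comparing their two ends, without any
    ancestor test. *)
Lemma proper_transversal x : x \in sA ++ sB -> proper x = transversal_pair T (pair_set x).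
Proof.
move=> xs; have xAB : pair_set x \in A :|: B.
  by move: xs; rewrite mem_cat inE => /orP[/(listed_pair lA)|/(listed_pair lB)] ->; rewrite ?orbT.
have [_ _ + _] := modelAB => /(_ _ xAB); rewrite /pair_set loop_set2 /proper.
case: eqP => [->|_ /orP[]//] _; rewrite transversal_set2.
by rewrite ancestor_refl.
Qed.

Lemma sibling_markP u : ~~ leaf T u ->
  (sibling_mark T sA sB u == 0) = (children T u \notin A :|: B).
Proof.
move=> lu.
have hasE s (S : {set {set V}}) : {subset s <= sA ++ sB} -> lists_pairs s S ->
    has (sibling_over T u) s = (children T u \in S).
  move=> sub ls; have [_ mE] := lists_pairsP ls; rewrite -mE.
  apply/hasP/mapP => [[x xs]|[x xs chE]].
    case/and3P=> xp /eqP p1 /eqP p2; exists x => //; move: (sub x xs) => /proper_transversal.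
    rewrite /proper xp transversal_set2 => /esym/andP[n1 n2].
    (* The root, being its own parent, has the same parent as its children; transversality excludes
       such a pair, because the root is above every node. *)
    have nr z z' : ~~ ancestor T z z' -> z != tree_root T.
      by apply: contraNneq => ->; apply: ancestor_root.
    by apply: children_eq2; rewrite ?in_children ?(nr _ _ n1) ?(nr _ _ n2) ?p1 ?p2 ?eqxx.
  exists x => //; have [x1 x2] : x.1 \in children T u /\ x.2 \in children T u.
    by rewrite chE set21 set22.
  have xp : x.1 != x.2.
    have := card_children binT u; rewrite chE lu /pair_set cards2.
    by case: eqP.
  by move: x1 x2; rewrite !in_children /sibling_over xp => /andP[_ ->] /andP[_ ->].
rewrite /sibling_mark (hasE sA A) ?(hasE sB B) ?inE //.
- by case: (_ \in B); case: (_ \in A).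
- by move=> x; rewrite mem_cat => ->; rewrite orbT.
- by move=> x; rewrite mem_cat => ->.
Qed.

Variable e : V -> nat.

(** A code lists each pair exactly once. Kept pairs inherit this from the input, added pairs
    determine their parents, and no added pair is a kept one because it lies outside [A :|: B]. *)
Lemma lists_emitted s (S : {set {set V}}) sg : lists_pairs s S -> S \subset A :|: B ->
  {subset s <= sA ++ sB} ->
  lists_pairs (emitted T s e (sibling_mark T sA sB) sg) (loopless T A B e S sg).
Proof.
move=> ls SAB sub; have [us mE] := lists_pairsP ls.
set mk := sibling_mark T sA sB.
have splitsE u : splits T e mk sg u = (u \in new_nodes T A B e sg).
  rewrite /splits inE; case: (boolP (leaf T u)) => lu; first by rewrite !andbF.
  by rewrite sibling_markP.
have kidE u : u \in new_nodes T A B e sg -> pair_set (kid_pair T u) = children T u.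
  rewrite inE => /and3P[_ _ /(kids_inner binT)[a [b [kE -> _]]]].
  by rewrite /pair_set /kid_pair kE.
have newE : [seq pair_set x | x <- [seq kid_pair T u | u <- enum V & splits T e mk sg u]] =
    [seq children T u | u <- enum V & splits T e mk sg u].
  rewrite -map_comp; apply/eq_in_map => u; rewrite mem_filter => /andP[].
  by rewrite splitsE => /kidE.
have newP p : reflect (exists2 u, u \in new_nodes T A B e sg & p = children T u)
    (p \in [seq children T u | u <- enum V & splits T e mk sg u]).
  apply: (iffP mapP) => -[u]; rewrite ?mem_filter ?splitsE.
    by case/andP=> h _ ->; exists u.
  by move=> h ->; exists u; rewrite // mem_filter splitsE h mem_enum.
have oldE p : (p \in [seq pair_set x | x <- s & proper x]) = (p \in S) && transversal_pair T p.
  apply/mapP/andP => [[x]|[pS tp]].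
    rewrite mem_filter => /andP[px xs] ->.
    by rewrite -(proper_transversal (sub _ xs)) (listed_pair ls).
  move: pS; rewrite -mE => /mapP[x xs pE]; exists x => //.
  by rewrite mem_filter xs (proper_transversal (sub _ xs)) -pE tp.
apply: uniq_perm; rewrite ?enum_uniq ?map_cat //.
  rewrite -[map _ (map _ _)]/(map pair_set _) newE cat_uniq; apply/and3P; split.
  - by apply: subseq_uniq us; apply/map_subseq/filter_subseq.
  - apply/hasPn => p /newP[u uN ->]; rewrite oldE negb_and.
    move: uN; rewrite inE => /and3P[_ nAB _]; apply/orP; left.
    by apply: contra nAB => /(subsetP SAB).
  - rewrite map_inj_in_uniq; first exact: filter_uniq (enum_uniq _).
    move=> u v; rewrite !mem_filter splitsE inE => /andP[/and3P[_ _ lu] _] _.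
    exact: children_inj.
move=> p; rewrite -[map _ (map _ _)]/(map pair_set _) newE mem_cat mem_enum oldE !inE.
by congr (_ || _); apply/newP/imsetP => -[u uN ->]; exists u.
Qed.

End ListedPairs.

Theorem lemma2p4 :
  exists (P : command) (c : nat),
  forall (V : finType) (T : rooted_tree V) (A B : {set {set V}}) (l : seq nat),
    signed_tree_model_with_loops T A B -> model_code T A B l ->
  exists (A' B' : {set {set V}}) (l' : seq nat),
    model_code T A' B' l' /\
    linear_time_run P c l l' /\
    signed_tree_model T A' B' /\
    represented_graph T A' B' =2 represented_graph T A B /\
    [set p in A | transversal_pair T p] \subset A' /\
    [set p in B | transversal_pair T p] \subset B' /\
    trivIset (new_pairs A B A' B') /\
    #|new_pairs A B A' B'| <= #|[set v | leaf T v]|.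
Proof.
exists unloop_code, 500 => V T A B l modelAB [sA [sB [lA lB lE]]].
have [binT _ _ _] := modelAB.
have szl : size l = input_size sA sB by rewrite lE; apply: size_input_code.
(* The constant of the running time also bounds the words, which leaves far more than the [20 * L]
   required. *)
have wL : 20 * input_size sA sB <= 500 * size l by rewrite szl; lia.
have [m [s [ex tm [e eP out]]]] := unloop_terminates binT wL.
have {}eP : propagates T (loop_label A B) e by move=> v; rewrite eP !(loop_labE lA lB).
exists (loopless T A B e A 1), (loopless T A B e B 2), (output_code T sA sB e).
split.
  exists (emitted T sA e (sibling_mark T sA sB) 1), (emitted T sB e (sibling_mark T sA sB) 2).
  split=> //; apply: lists_emitted => //; rewrite ?subsetUl ?subsetUr // => x xs.
    by rewrite mem_cat xs.
  by rewrite mem_cat xs orbT.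
split; first by exists m, s; rewrite szl; split=> //; rewrite lE -szl.
split; first exact: loopless_model.
split; first exact: loopless_graph.
by rewrite !subsetUl; split=> //; split=> //; split;
  [exact: trivIset_new_pairs|exact: card_new_pairs].
Qed.
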